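(* The Lie algebra ${\cal L}^1$ is a free Lie algebra.
   Context: A rooted tree is a finite connected and simply connected graph with a distinguished vertex (the root), edges oriented away from the root; its weight is its number of vertices. For rooted trees $t_1,t_2,t$, $n(t_1,t_2;t)$ is the number of edges $e$ of $t$ such that removing $e$ leaves a tree isomorphic to $t_1$ (the component not containing the root) and a tree isomorphic to $t_2$ (the component containing the root). ${\cal L}^1$ is the $\mathbb{Q}$-vector space with basis $(Z_t)$ indexed by isomorphism classes of rooted trees, with Lie bracket $[Z_{t_1},Z_{t_2}]=\sum_tn(t_1,t_2;t)Z_t-\sum_tn(t_2,t_1;t)Z_t$. *)

(* Defs.v *)
From HB Require Import structures.
From mathcomp Require Import all_boot all_order all_algebra.
From mathcomp Require Import classical_sets fsbigop.
From mathcomp.multinomials Require Import monalg.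

Set Implicit Arguments.
Unset Strict Implicit.
Unset Printing Implicit Defensive.

Import GRing.Theory.
Local Open Scope ring_scope.

Definition is_lie (V : lmodType rat) (br : V -> V -> V) : Prop :=
  [/\ (forall (a : rat) (x y z : V), br (a *: x + y) z = a *: br x z + br y z),
      (forall (a : rat) (x y z : V), br x (a *: y + z) = a *: br x y + br x z),
      (forall x : V, br x x = 0) &
      (forall x y z : V, br x (br y z) + br y (br z x) + br z (br x y) = 0)].

Record lieAlgebra := LieAlgebra {
  lie_sort :> lmodType rat;
  lie_br : lie_sort -> lie_sort -> lie_sort;
  lie_axioms : is_lie lie_br }.

Definition is_lie_morphism (V W : lmodType rat) (brV : V -> V -> V)
  (brW : W -> W -> W) (phi : V -> W) : Prop :=
  (forall (a : rat) (x y : V), phi (a *: x + y) = a *: phi x + phi y) /\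
  (forall x y : V, phi (brV x y) = brW (phi x) (phi y)).

Definition is_free_lie (V : lmodType rat) (br : V -> V -> V) : Prop :=
  is_lie br /\
  exists X : V -> Prop, forall (M : lieAlgebra) (f : V -> M),
    (exists phi : V -> M, is_lie_morphism br (@lie_br M) phi /\
                          (forall x, X x -> phi x = f x)) /\
    (forall phi psi : V -> M,
        is_lie_morphism br (@lie_br M) phi -> is_lie_morphism br (@lie_br M) psi ->
        (forall x, X x -> phi x = psi x) -> forall v, phi v = psi v).

(* A (non-planar) rooted tree is represented by a planar one: a root with an
   ordered list of subtrees; isomorphism classes are handled through canonical
   forms below. *)
Inductive rtree := RNode of seq rtree.

Fixpoint rtree_enc (t : rtree) : GenTree.tree nat :=
  let: RNode ts := t in GenTree.Node 0 (map rtree_enc ts).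

Fixpoint rtree_dec (g : GenTree.tree nat) : rtree :=
  match g with
  | GenTree.Leaf _ => RNode [::]
  | GenTree.Node _ gs => RNode (map rtree_dec gs)
  end.

Lemma rtree_encK_aux (t : rtree) : rtree_dec (rtree_enc t) = t.
Proof.
move: t; fix IH 1; case=> ts /=; congr RNode.
elim: ts => //= t ts IHts; by rewrite IH IHts.
Qed.

Lemma rtree_encK : cancel rtree_enc rtree_dec.
Proof. exact: rtree_encK_aux. Qed.

HB.instance Definition _ := Countable.copy rtree (can_type rtree_encK).

Fixpoint weight (t : rtree) : nat :=
  let: RNode ts := t in (sumn (map weight ts)).+1.

Fixpoint canon (t : rtree) : rtree :=
  let: RNode ts := t in
  RNode (sort (fun a b => pickle a <= pickle b)%N (map canon ts)).

Definition tree_iso (t u : rtree) : bool := canon t == canon u.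

(* the type of isomorphism classes of rooted trees *)
Definition ctree := {t : rtree | canon t == t}.

(* For each edge e of t (identified with its end far from the root), the pair
   (component not containing the root, component containing the root)
   obtained by removing e. *)
Fixpoint cuts (t : rtree) : seq (rtree * rtree) :=
  let: RNode ts := t in
  let fix go (pre l : seq rtree) : seq (rtree * rtree) :=
    match l with
    | [::] => [::]
    | c :: l' =>
        (c, RNode (pre ++ l'))
          :: [seq (p.1, RNode (pre ++ p.2 :: l')) | p <- cuts c]
          ++ go (rcons pre c) l'
    end in
  go [::] ts.

Definition ncut (t1 t2 t : ctree) : nat :=
  count (fun p => tree_iso p.1 (val t1) && tree_iso p.2 (val t2)) (cuts (val t)).

Definition L1 := {malg rat[ctree]}.
HB.instance Definition _ := GRing.Lmodule.on L1.

Definition Z (t : ctree) : L1 := << t >>.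

Local Open Scope classical_set_scope.

Definition br_basis (t1 t2 : ctree) : L1 :=
  (\sum_(t \in [set: ctree]) (ncut t1 t2 t)%:R *: Z t)%R -
  (\sum_(t \in [set: ctree]) (ncut t2 t1 t)%:R *: Z t)%R.

Local Close Scope classical_set_scope.

Definition br1 (x y : L1) : L1 :=
  \sum_(t1 <- finmap.enum_fset (msupp x)) \sum_(t2 <- finmap.enum_fset (msupp y)) (x@_t1 * y@_t2) *: br_basis t1 t2.

(* Main.v *)
(** Rescaling [Z t] by the order of the automorphism group of [t] turns the bracket
into the commutator of the grafting product, whose pre-Lie identity gives Jacobi.
Let the generators be the tree classes that are not, modulo brackets, combinations
of earlier classes of the same weight; there is a projection onto their span
that kills all brackets. Call it [pi].

For freeness, a linear form on trees killing brackets extends uniquely to forests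
so as to vanish on decomposable elements of the enveloping algebra (spanned by
forests, as for any pre-Lie algebra). Detaching from a forest, at one vertex, some of
the subtrees above it gives a coproduct-like splitting which is compatible
with left multiplication by trees. Evaluating the extended form on the second
part and recursing on the first one, every family of operators on a space [V]
killing brackets thus yields an action of the Lie algebra on [V], and composing
with [pi] and correcting by recursion on the weight, the generators can be made to act by
prescribed operators.

Given a Lie algebra [M] and [f], let a generator [x] of weight [n] act on
[M * rat] by [(m, q) |-> ([f x, m] + q n f x, 0)]. Then every element [z] of weight
[n] acts as [(m, q) |-> ([p, m] + q n p, 0)] for a unique [p] in [M], and [z |-> p]
is the desired morphism. *)

From HB Require Import structures.
From mathcomp Require Import all_boot all_order all_algebra.
From mathcomp Require Import classical_sets fsbigop.
From mathcomp.multinomials Require Import monalg.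
From mathcomp Require Import finmap.
From mathcomp Require boolp.
Require Import Defs.

Set Implicit Arguments.
Unset Strict Implicit.
Unset Printing Implicit Defensive.

Import Order.TTheory GRing.Theory Num.Theory.
Local Open Scope ring_scope.

Notation forest := (seq rtree).

Implicit Types (t u : rtree) (F G H K S R : forest).

(** A forest is treated as a binary tree, with one hypothesis for the forest below the first root
    and one for the remaining trees; this replaces nested induction on [rtree]. *)
Lemma forest_ind (P : forest -> Prop) :
  P [::] -> (forall K F, P K -> P F -> P (RNode K :: F)) -> forall F, P F.
Proof.
move=> P0 PS.
have PT : forall t, P (let: RNode K := t in K).
  fix IH 1; case=> K; elim: K => //.
  by move=> t K IHK; have := IH t; case: t => K' PK'; apply: PS.
by move=> F; apply: (PT (RNode F)).
Qed.

(** * Forests and graftings *)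

(** The root of [t] becomes a child of a vertex of [u]; the list has one entry per vertex. The inner
    fixpoint gets the name [gf] below. *)
Fixpoint gr t u {struct u} : seq rtree :=
  let: RNode F := u in
  map RNode ((t :: F) ::
    (fix gf F := match F with
       | [::] => [::]
       | c :: F' => [seq x :: F' | x <- gr t c] ++ [seq c :: F'' | F'' <- gf F']
       end) F).

Definition gf t := fix gf F : seq forest :=
  match F with
  | [::] => [::]
  | c :: F' => [seq x :: F' | x <- gr t c] ++ [seq c :: F'' | F'' <- gf F']
  end.

Lemma gf_cons t c F :
  gf t (c :: F) = [seq x :: F | x <- gr t c] ++ [seq c :: F' | F' <- gf t F].
Proof. by []. Qed.

(** The Oudom-Guin product of a tree and a forest in the enveloping algebra, modelled on forests. It
    also lists the graftings of [t] on [RNode F], with that root stripped. *)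
Definition star t F : seq forest := (t :: F) :: gf t F.

Lemma gr_RNode t F : gr t (RNode F) = map RNode (star t F).
Proof. by []. Qed.

(* [abel] proves equalities of sums in a [zmodType] up to associativity and
   commutativity. *)
Ltac abel_front a e :=
  match e with
  | ?b + _ => let _ := constr:(erefl a : a = b) in constr:(erefl e)
  | ?b + ?r =>
      let p := abel_front a r in
      constr:(etrans (congr1 (fun z => b + z) p) (addrCA b a _))
  end.
Ltac abel :=
  rewrite -[LHS]addr0 -[RHS]addr0 -?addrA;
  repeat (match goal with
  | |- ?a + _ = ?e =>
      let p := abel_front a e in
      apply: (etrans _ (esym p)); congr (_ + _) => //
  end).

(** Isomorphism of forests, generated by adjacent swaps at every depth, so that invariance can be
    checked generator by generator. [feq_canon] and [canonP] identify it with equality of canonical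
    forms. *)
Inductive feq : forest -> forest -> Prop :=
| feq_nil : feq [::] [::]
| feq_cons K K' F F' :
    feq K K' -> feq F F' -> feq (RNode K :: F) (RNode K' :: F')
| feq_swap t u F : feq (t :: u :: F) (u :: t :: F)
| feq_trans F G H : feq F G -> feq G H -> feq F H.

Lemma feq_refl F : feq F F.
Proof. by elim/forest_ind: F => *; constructor. Qed.

Lemma feq_sym F G : feq F G -> feq G F.
Proof.
elim=> [|K K' {}F F' _ IHK _ IHF|t u {}F|{}F {}G H _ IH1 _ IH2].
- exact: feq_nil.
- exact: feq_cons.
- exact: feq_swap.
- exact: feq_trans IH2 IH1.
Qed.

Lemma feq_cons2 t F F' : feq F F' -> feq (t :: F) (t :: F').
Proof. by case: t => K FF'; apply: feq_cons => //; apply: feq_refl. Qed.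

Lemma feq_head K K' F : feq K K' -> feq (RNode K :: F) (RNode K' :: F).
Proof. by move=> KK'; apply: feq_cons => //; apply: feq_refl. Qed.

Lemma feq_perm F F' : perm_eq F F' -> feq F F'.
Proof.
have feq_front t G H : feq (t :: G ++ H) (G ++ t :: H).
  elim: G => [|u G IHG] /=; first exact: feq_refl.
  exact: feq_trans (feq_swap _ _ _) (feq_cons2 _ IHG).
elim: F F' => [|t F IHF] F' eqF.
  by move: (perm_size eqF); case: F' {eqF} => // _; apply: feq_nil.
have tF' : t \in F' by rewrite -(perm_mem eqF) mem_head.
case/splitPr: tF' eqF => G H eqF; apply: feq_trans (feq_front t G H).
apply: feq_cons2; apply: IHF.
by rewrite perm_sym -(perm_cons t) perm_sym (permPl eqF) perm_catC /= perm_cons perm_catC.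
Qed.

Definition ple (a b : rtree) := (choice.pickle a <= choice.pickle b)%N.

Lemma canonE F : canon (RNode F) = RNode (sort ple (map canon F)).
Proof. by []. Qed.

Lemma feq_canon F G : feq F G -> canon (RNode F) = canon (RNode G).
Proof.
have sortP F1 F2 : perm_eq F1 F2 -> sort ple F1 = sort ple F2.
  apply/perm_sortP.
  - by move=> a b; apply: leq_total.
  - by move=> a b c; apply: leq_trans.
  - by move=> a b; rewrite -eqn_leq => /eqP /(pcan_inj choice.pickleK).
elim=> [|K K' {}F F' _ IHK _ IHF|t u {}F|{}F {}G H _ -> _ ->] //.
  rewrite !canonE; congr RNode; apply: sortP.
  rewrite !map_cons IHK perm_cons.
  move: IHF; rewrite !canonE => -[] eqs.
  by rewrite -(perm_sort ple) eqs perm_sort.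
rewrite !canonE; congr RNode; apply: sortP.
exact: (permEl (perm_catCA [:: canon t] [:: canon u] _)).
Qed.

Definition children t := let: RNode F := t in F.

Lemma childrenK t : RNode (children t) = t. Proof. by case: t. Qed.

Lemma canon_feq F : feq F (children (canon (RNode F))).
Proof.
elim/forest_ind: F => [|K F IHK IHF]; first exact: feq_nil.
apply: feq_trans (feq_cons IHK IHF) _; apply: feq_perm.
by rewrite childrenK !canonE /= perm_sym !perm_sort perm_cons perm_sym perm_sort.
Qed.

Lemma canonP F G : canon (RNode F) = canon (RNode G) -> feq F G.
Proof.
move=> eqFG; apply: feq_trans (canon_feq F) _.
by rewrite eqFG; apply/feq_sym/canon_feq.
Qed.

Lemma canon_idem t : canon (canon t) = canon t.
Proof.
case: t => F; rewrite -{1}(childrenK (canon (RNode F))).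
exact/esym/feq_canon/canon_feq.
Qed.

Definition invariant_on (V : Type) (f : forest -> V) :=
  forall F G, feq F G -> f F = f G.

Section Graftings.

Variable V : zmodType.
Implicit Types f : forest -> V.

Lemma sum_gr t F (f : rtree -> V) :
  \sum_(x <- gr t (RNode F)) f x = \sum_(H <- star t F) f (RNode H).
Proof. by rewrite gr_RNode big_map. Qed.

Lemma sum_star t F f :
  \sum_(H <- star t F) f H = f (t :: F) + \sum_(H <- gf t F) f H.
Proof. by rewrite /star big_cons. Qed.

Lemma sum_gf_nil t f : \sum_(H <- gf t [::]) f H = 0.
Proof. by rewrite big_nil. Qed.

Lemma sum_gf_cons t K F f :
  \sum_(H <- gf t (RNode K :: F)) f H
  = \sum_(K' <- star t K) f (RNode K' :: F)
    + \sum_(F' <- gf t F) f (RNode K :: F').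
Proof. by rewrite gf_cons big_cat !big_map -(sum_gr t K (fun x => f (x :: F))). Qed.

Lemma invariant_cons f t : invariant_on f -> invariant_on (fun F => f (t :: F)).
Proof. by move=> fP F G FG; apply/fP/feq_cons2. Qed.

Lemma invariant_head f F :
  invariant_on f -> invariant_on (fun K => f (RNode K :: F)).
Proof. by move=> fP K G KG; apply/fP/feq_head. Qed.

Lemma sum_gf_feq f T T' F F' : invariant_on f -> feq T T' -> feq F F' ->
  \sum_(H <- gf (RNode T) F) f H = \sum_(H <- gf (RNode T') F') f H.
Proof.
move=> fP TT' FF'.
(* The grafted tree varies first, with the forest fixed; the induction on [feq F F'] comes
   afterwards. *)
have step1 : \sum_(H <- gf (RNode T) F) f H = \sum_(H <- gf (RNode T') F) f H.
  elim/forest_ind: F {F' FF'} f fP => [|K F IHK IHF] f fP; first by rewrite !big_nil.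
  rewrite !sum_gf_cons !sum_star (IHK _ (invariant_head _ fP)).
  rewrite (IHF _ (invariant_cons _ fP)); congr (_ + _ + _); apply: fP.
  exact/feq_head/feq_cons/feq_refl.
rewrite {}step1; elim: FF' f fP => {F F'} [|K K' F F' KK' IHK FF' IHF|t u F|F G H _ IH1 _ IH2] f fP.
- by [].
- rewrite !sum_gf_cons !sum_star (IHK _ (invariant_head _ fP)) (IHF _ (invariant_cons _ fP)).
  congr (_ + _ + _); first by apply/fP/feq_cons/FF'/feq_cons2.
    by apply: eq_bigr => H _; apply/fP/feq_cons2.
  by apply: eq_bigr => H _; apply/fP/feq_head.
- case: t u => [K] [K']; rewrite !sum_gf_cons addrCA; congr (_ + (_ + _)).
  + by apply: eq_bigr => H _; apply/fP/feq_swap.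
  + by apply: eq_bigr => H _; apply/fP/feq_swap.
  + by apply: eq_bigr => H _; apply/fP/feq_swap.
- by rewrite IH1 // IH2.
Qed.

(* Symmetric in [T] and [T']: it counts the ways to graft [RNode T] and [RNode T']
   independently on [G], plus those where one is first grafted on the other. *)
Definition gf_gf f T T' G :=
  \sum_(H <- gf (RNode T') G) \sum_(H' <- gf (RNode T) H) f H'
  + \sum_(X <- star (RNode T') T) \sum_(H <- gf (RNode X) G) f H.

(** Induction on [G]. Graftings that involve the first root, or both the first tree and the rest,
    form sums symmetric in the two grafted trees, up to the order of two children of that root,
    where invariance of [f] enters. What remains is the same identity for [K] and for [G]. *)
Lemma gf_preLie f T T' G : invariant_on f -> gf_gf f T T' G = gf_gf f T' T G.
Proof.
elim/forest_ind: G f => [|K G IHK IHG] f fP.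
  have gf0 A B : gf_gf f A B [::] = 0.
    by rewrite /gf_gf sum_gf_nil add0r big1 // => X _; apply: sum_gf_nil.
  by rewrite !gf0.
have eK := IHK _ (invariant_head G fP); have eG := IHG _ (invariant_cons (RNode K) fP).
have expand A B : gf_gf f A B (RNode K :: G) =
  (\sum_(K' <- gf (RNode B) K) f [:: RNode (RNode A :: K') & G] +
   \sum_(K' <- gf (RNode A) K) f [:: RNode (RNode B :: K') & G] +
   f [:: RNode [:: RNode A, RNode B & K] & G] +
   (\sum_(X <- star (RNode A) B) f [:: RNode (RNode X :: K) & G]
    + \sum_(X <- star (RNode B) A) f [:: RNode (RNode X :: K) & G])) +
  (\sum_(K' <- star (RNode B) K) \sum_(G' <- gf (RNode A) G) f (RNode K' :: G') +
   \sum_(K' <- star (RNode A) K) \sum_(G' <- gf (RNode B) G) f (RNode K' :: G')) +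
  gf_gf (fun K' => f (RNode K' :: G)) A B K +
  gf_gf (fun G' => f (RNode K :: G')) A B G.
  rewrite /gf_gf sum_gf_cons.
  under eq_bigr do rewrite sum_gf_cons.
  under [X in _ + X + _ = _]eq_bigr do rewrite sum_gf_cons.
  rewrite !big_split /=.
  under [X in _ + X = _]eq_bigr do rewrite sum_gf_cons sum_star.
  rewrite !big_split /=.
  rewrite [X in X + _ + _ + _ = _]sum_star sum_star sum_gf_cons.
  under [\sum_(i <- gf (RNode B) K) \sum_(H <- star _ _) _]eq_bigr do rewrite sum_star.
  rewrite !big_split /=.
  rewrite [\sum_(i <- gf (RNode B) G) _]exchange_big /=.
  by abel.
rewrite !expand eK eG; congr (_ + _ + _ + _); last exact: addrC.
congr (_ + _); last exact: addrC.
congr (_ + _); first exact: addrC.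
by apply/fP/feq_head/feq_swap.
Qed.

End Graftings.

(** * Extension of forms from trees to forests *)

Definition fweight F := sumn (map weight F).

Lemma weightE K : weight (RNode K) = (fweight K).+1. Proof. by []. Qed.

Lemma fweight_cons t F : fweight (t :: F) = (weight t + fweight F)%N.
Proof. by []. Qed.

Lemma fweight_eq0 F : (fweight F == 0)%N = nilp F.
Proof. by case: F => [|[K] F]. Qed.

Lemma feq_size F G : feq F G -> size F = size G.
Proof. by elim=> //= [*|*]; congruence. Qed.

Lemma feq_fweight F G : feq F G -> fweight F = fweight G.
Proof.
elim=> [|K K' {}F F' _ IHK _ IHF|t u {}F|{}F {}G H _ -> _ ->] //.
  by rewrite !fweight_cons !weightE IHK IHF.
by rewrite !fweight_cons addnCA.
Qed.

Lemma gf_size_weight t F H : H \in gf t F ->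
  size H = size F /\ fweight H = (weight t + fweight F)%N.
Proof.
elim/forest_ind: F H => [|K F IHK IHF] H //.
rewrite gf_cons mem_cat => /orP[] /mapP[].
  move=> x; rewrite gr_RNode => /mapP[K' + ->] -> /=.
  rewrite !fweight_cons !weightE inE => /orP[/eqP ->|/IHK[_ ->]].
    by rewrite fweight_cons addnS addSn addnA.
  by rewrite addnS addSn addnA.
move=> F' /IHF[sF wF] -> /=; rewrite !fweight_cons sF wF.
by split=> //; rewrite addnCA.
Qed.

Lemma star_weight t F H : H \in star t F -> fweight H = (weight t + fweight F)%N.
Proof. by rewrite inE => /orP[/eqP -> //|/gf_size_weight[]]. Qed.

Lemma star_neq0 t F H : H \in star t F -> H != [::].
Proof. by move/star_weight; case: H => //; case: t. Qed.

Section ExtendToForests.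

Variable V : zmodType.
Implicit Types g : forest -> V.

(** Setting the sum over [star t G] to 0 expresses the value at [t :: G] through forests with one
    tree less. The index [n] is the number of trees minus one; forests of any other length get 0. *)
Fixpoint ghn g n F : V :=
  match n, F with
  | 0, [:: RNode K] => g K
  | n'.+1, t :: G => - \sum_(H <- gf t G) ghn g n' H
  | _, _ => 0
  end.

(* The extension to forests of a linear form on trees that makes it vanish on
   all the [star t F] with [F] nonempty, i.e. on the decomposable elements of
   the enveloping algebra. *)
Definition gh g F := ghn g (size F).-1 F.

(** Grafting preserves total weight, so only trees as heavy as [F] are ever evaluated. This locality
    is what permits later recursions on the weight. *)
Lemma ghn_local g g' n F :
  (forall K, (fweight K).+1 = fweight F -> g K = g' K) -> ghn g n F = ghn g' n F.
Proof.
elim: n F => [|n IHn] [|[K] F] gg' //=.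
  by case: F gg' => // gg'; apply: gg'; rewrite fweight_cons weightE addn0.
congr (- _); rewrite !big_seq; apply: eq_bigr => H /gf_size_weight[_ wH].
by apply: IHn => L wL; apply: gg'; rewrite wL wH fweight_cons.
Qed.

Lemma gh_local g g' F :
  (forall K, (fweight K).+1 = fweight F -> g K = g' K) -> gh g F = gh g' F.
Proof. exact: ghn_local. Qed.

Lemma gh_star g t F : F != [::] -> \sum_(H <- star t F) gh g H = 0.
Proof.
rewrite sum_star; case: F => // u F _; rewrite {1}/gh [size _]/= [ghn _ _ _]/=.
apply/eqP; rewrite addrC subr_eq0; apply/eqP.
rewrite !big_seq; apply: eq_bigr => H /gf_size_weight[sH _].
by rewrite /gh sH.
Qed.

Definition kills_brackets g := forall T T',
  \sum_(X <- star (RNode T) T') g X = \sum_(X <- star (RNode T') T) g X.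

(** The delicate case is the exchange of the first two trees. For [n] at least 2, unfolding twice
    produces [gf_gf], symmetric by [gf_preLie]; for [n = 1] the exchange is the hypothesis that [g]
    kills brackets. *)
Lemma ghn_invariant g n :
  invariant_on g -> kills_brackets g -> invariant_on (ghn g n).
Proof.
move=> gP gB; elim/ltn_ind: n => -[|n] IHn.
  move=> F G FG; elim: FG => [|K K' {}F F' KK' _ FF' _|t u {}F|{}F {}G H _ -> _ ->] //=.
    by move/feq_size: FF'; case: F F' => [|? ?] [|? ?] //= _; apply: gP.
  by case: t u => [?] [?].
move=> F G FG; elim: FG => [|K K' {}F F' KK' _ FF' _|[T] [T'] {}F|{}F {}G H _ -> _ ->] //.
  by rewrite [LHS]/= [RHS]/=; congr (- _); apply: sum_gf_feq => //; apply: IHn.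
rewrite [LHS]/= [RHS]/= -!/(gf _ (_ :: _)); congr (- _); rewrite !sum_gf_cons.
case: n IHn => [|n] IHn; last first.
  have e A B : \sum_(X <- star (RNode A) B) ghn g n.+1 (RNode X :: F)
      + \sum_(F' <- gf (RNode A) F) ghn g n.+1 (RNode B :: F')
      = - gf_gf (ghn g n) B A F.
    by rewrite /gf_gf opprD -!sumrN addrC.
  by rewrite !e; congr (- _); apply/gf_preLie/IHn.
(* Here only forests of two trees have the right length; longer ones give 0 on both sides. *)
case: F => [|u F].
  by rewrite !sum_gf_nil !addr0; apply: gB.
by rewrite !big1_seq ?addr0 // => H /andP[_ /gf_size_weight[]]; case: H.
Qed.

Lemma gh_invariant g : invariant_on g -> kills_brackets g -> invariant_on (gh g).
Proof.
by move=> gP gB F G FG; rewrite /gh (feq_size FG); apply: ghn_invariant.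
Qed.

End ExtendToForests.

Lemma ghn_linear (V : lmodType rat) (a : rat) (g g1 g2 : forest -> V) n F :
  (forall K, g K = a *: g1 K + g2 K) ->
  ghn g n F = a *: ghn g1 n F + ghn g2 n F.
Proof.
move=> gE; elim: n F => [|n IHn] [|[K] F] /=; rewrite ?scaler0 ?addr0 //.
  by case: F => [|u F] //=; rewrite scaler0 addr0.
rewrite scalerN -opprD; congr (- _).
by rewrite scaler_sumr -big_split; apply: eq_bigr => H _; apply: IHn.
Qed.

Lemma gh_linear (V : lmodType rat) (a : rat) (g g1 g2 : forest -> V) F :
  (forall K, g K = a *: g1 K + g2 K) -> gh g F = a *: gh g1 F + gh g2 F.
Proof. exact: ghn_linear. Qed.

(** * Splittings of forests *)

Fixpoint spl K : seq (forest * forest) :=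
  match K with
  | [::] => [:: ([::], [::])]
  | u :: K' => [seq (u :: p.1, p.2) | p <- spl K'] ++
               [seq (p.1, u :: p.2) | p <- spl K']
  end.

(* The pairs [(S, R)] obtained from a forest by choosing a vertex [v] and
   detaching a set [S] of subtrees whose roots are children of [v]; in [sk] the
   trees are represented by the forests below their roots. *)
Fixpoint skt t : seq (forest * forest) :=
  let: RNode K := t in
  spl K ++ (fix sf K : seq (forest * forest) := match K with
    | [::] => [::]
    | c :: K' => [seq (p.1, RNode p.2 :: K') | p <- skt c] ++
                 [seq (p.1, c :: p.2) | p <- sf K']
    end) K.
Definition sk K := skt (RNode K).
Definition sf := fix sf K : seq (forest * forest) := match K with
    | [::] => [::]
    | c :: K' => [seq (p.1, RNode p.2 :: K') | p <- skt c] ++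
                 [seq (p.1, c :: p.2) | p <- sf K']
    end.

Lemma skE K : sk K = spl K ++ sf K. Proof. by []. Qed.
Lemma sf_cons K F : sf (RNode K :: F) =
  [seq (p.1, RNode p.2 :: F) | p <- sk K] ++ [seq (p.1, RNode K :: p.2) | p <- sf F].
Proof. by []. Qed.

Lemma spl_weight K p : p \in spl K -> fweight K = (fweight p.1 + fweight p.2)%N.
Proof.
elim: K p => [|u K IHK] p; first by rewrite inE => /eqP ->.
rewrite /= mem_cat => /orP[] /mapP[q /IHK wq -> /=]; rewrite !fweight_cons wq.
  by rewrite addnA.
by rewrite addnCA.
Qed.

Lemma sf_weight K p : p \in sf K ->
  p.2 != [::] /\ fweight K = (fweight p.1 + fweight p.2)%N.
Proof.
elim/forest_ind: K p => [|K F IHK IHF] p //.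
rewrite sf_cons skE mem_cat => /orP[] /mapP[q].
  rewrite mem_cat => qK -> /=; split=> //; rewrite !fweight_cons !weightE.
  have -> : fweight K = (fweight q.1 + fweight q.2)%N; last by rewrite !addSn addnS addnA.
  by case/orP: qK => [/spl_weight //|/IHK[]].
by move=> /IHF[_ wF] -> /=; split=> //; rewrite !fweight_cons wF addnCA.
Qed.

Lemma sk_weight K p : p \in sk K -> fweight K = (fweight p.1 + fweight p.2)%N.
Proof. by rewrite skE mem_cat => /orP[/spl_weight //|/sf_weight[]]. Qed.

Section Splittings.

Variable V : zmodType.
Implicit Types Phi : forest -> forest -> V.

Lemma sum_spl_cons u K Phi :
  \sum_(p <- spl (u :: K)) Phi p.1 p.2
  = \sum_(p <- spl K) (Phi (u :: p.1) p.2 + Phi p.1 (u :: p.2)).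
Proof. by rewrite [RHS]big_split [spl _]/= big_cat !big_map. Qed.

Lemma sum_sk K Phi : \sum_(p <- sk K) Phi p.1 p.2
  = \sum_(p <- spl K) Phi p.1 p.2 + \sum_(p <- sf K) Phi p.1 p.2.
Proof. by rewrite skE big_cat. Qed.

Lemma sum_sf_cons K F Phi :
  \sum_(p <- sf (RNode K :: F)) Phi p.1 p.2
  = \sum_(p <- sk K) Phi p.1 (RNode p.2 :: F)
    + \sum_(p <- sf F) Phi p.1 (RNode K :: p.2).
Proof. by rewrite sf_cons big_cat !big_map. Qed.

(** Splitting moves whole trees only, so the vertex receiving [t] lies either in the detached or in
    the remaining part. *)
Lemma sum_spl_gf t K Phi :
  \sum_(H <- gf t K) \sum_(p <- spl H) Phi p.1 p.2
  = \sum_(p <- spl K) (\sum_(S <- gf t p.1) Phi S p.2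
                       + \sum_(R <- gf t p.2) Phi p.1 R).
Proof.
elim: K Phi => [|[K0] K IHK] Phi.
  by rewrite sum_gf_nil big_seq1 !sum_gf_nil addr0.
rewrite [RHS](sum_spl_cons _ _ (fun S R => \sum_(S' <- gf t S) Phi S' R
  + \sum_(R' <- gf t R) Phi S R')).
rewrite [LHS]sum_gf_cons.
under eq_bigr do rewrite sum_spl_cons big_split /=.
under [X in _ + X = _]eq_bigr do rewrite sum_spl_cons big_split /=.
under [in RHS]eq_bigr do rewrite !sum_gf_cons.
rewrite !big_split /= (IHK (fun S => Phi (RNode K0 :: S))).
rewrite (IHK (fun S R => Phi S (RNode K0 :: R))).
rewrite !big_split /= ![\sum_(i <- star _ _) _]exchange_big /=.
by abel.
Qed.

(** If the chosen vertex lies in [G], the grafted tree is itself detached there or sits on a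
    detached tree (together, [star]), or else it sits on the remainder. If the vertex lies in [T],
    one may detach first and graft what is left of the tree. *)
Lemma sum_sf_gf T G Phi :
  \sum_(H <- gf (RNode T) G) \sum_(p <- sf H) Phi p.1 p.2
  = \sum_(p <- sf G) (\sum_(S <- star (RNode T) p.1) Phi S p.2
                      + \sum_(R <- gf (RNode T) p.2) Phi p.1 R)
    + \sum_(p <- sk T) \sum_(H <- gf (RNode p.2) G) Phi p.1 H.
Proof.
elim/forest_ind: G Phi => [|K G IHK IHG] Phi.
  by rewrite !big_nil add0r big1 // => p _; rewrite sum_gf_nil.
(* The same identity for a single tree, whose root may be the chosen vertex; it treats the graftings
   inside [RNode K]. *)
have star_sk (Psi : forest -> forest -> V) : \sum_(K' <- star (RNode T) K) \sum_(p <- sk K') Psi p.1 p.2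
  = \sum_(p <- sk K) (\sum_(S <- star (RNode T) p.1) Psi S p.2
                      + \sum_(R <- star (RNode T) p.2) Psi p.1 R)
    + \sum_(p <- sk T) \sum_(H <- star (RNode p.2) K) Psi p.1 H.
  rewrite (eq_bigr _ (fun K' _ => sum_sk K' Psi)).
  rewrite big_split /= [X in X + _ = _]sum_star [X in _ + X = _]sum_star.
  rewrite sum_spl_gf IHK sum_spl_cons sum_sf_cons.
  rewrite [X in _ = X + _](sum_sk _ (fun S R => \sum_(S' <- star (RNode T) S) Psi S' R
    + \sum_(R' <- star (RNode T) R) Psi S R')).
  under [\sum_(p <- spl K) (\sum_(S <- star _ _) _ + _)]eq_bigr do rewrite !sum_star.
  under [\sum_(p <- sf K) (_ + \sum_(S <- star _ _) _)]eq_bigr do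
    rewrite [X in _ + X]sum_star.
  under [\sum_(p <- sk T) \sum_(H <- star _ _) _]eq_bigr do rewrite sum_star.
  rewrite !big_split /=.
  by abel.
rewrite sum_gf_cons.
rewrite (eq_bigr _ (fun K' _ => sum_sf_cons K' G Phi)).
rewrite [X in _ + X](eq_bigr _ (fun G' _ => sum_sf_cons K G' Phi)).
rewrite [X in _ = _ + X](eq_bigr _ (fun p _ => sum_gf_cons _ _ _ _)).
rewrite [X in _ = X + _](sum_sf_cons _ _ (fun S R => \sum_(S' <- star (RNode T) S) Phi S' R
    + \sum_(R' <- gf (RNode T) R) Phi S R')).
under [\sum_(p <- sk K) (_ + \sum_(S <- gf _ _) _)]eq_bigr do
    rewrite [X in _ + X]sum_gf_cons.
under [\sum_(p <- sf G) (_ + \sum_(S <- gf _ _) _)]eq_bigr do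
    rewrite [X in _ + X]sum_gf_cons.
rewrite !big_split /= (star_sk (fun S R => Phi S (RNode R :: G))).
rewrite (IHG (fun S R => Phi S (RNode K :: R))) /=.
rewrite !big_split /=.
rewrite [\sum_(i <- star _ _) \sum_(p <- sf G) _]exchange_big.
rewrite [\sum_(i <- gf _ _) \sum_(p <- sk K) _]exchange_big /=.
by abel.
Qed.

(** The splittings of the juxtaposition [RNode T :: G] complete the graftings on the remainders in
    [sum_sf_gf] to products [star]. This is the compatibility of splitting with left
    multiplication. *)
Lemma sum_sf_star T G Phi :
  \sum_(H <- star (RNode T) G) \sum_(p <- sf H) Phi p.1 p.2
  = \sum_(p <- sf G) (\sum_(S <- star (RNode T) p.1) Phi S p.2
                      + \sum_(R <- star (RNode T) p.2) Phi p.1 R)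
    + \sum_(p <- sk T) \sum_(H <- star (RNode p.2) G) Phi p.1 H.
Proof.
rewrite sum_star sum_sf_cons sum_sf_gf.
under [\sum_(p <- sf G) (_ + \sum_(S <- star _ _) _)]eq_bigr do
    rewrite [X in _ + X]sum_star.
under [\sum_(p <- sk T) \sum_(H <- star _ _) _]eq_bigr do rewrite sum_star.
rewrite !big_split /=.
by abel.
Qed.

Definition invariant_on2 Phi := forall S S' R R',
  feq S S' -> feq R R' -> Phi S R = Phi S' R'.

Lemma sum_spl_feq Phi K K' : invariant_on2 Phi -> feq K K' ->
  \sum_(p <- spl K) Phi p.1 p.2 = \sum_(p <- spl K') Phi p.1 p.2.
Proof.
move=> PhiP KK'; elim: KK' Phi PhiP
  => {K K'} [|K K' F F' KK' IHK FF' IHF|t u F|F G H _ IH1 _ IH2] Phi PhiP.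
- by [].
- have inv1 : invariant_on2 (fun S R => Phi (RNode K :: S) R).
    by move=> S S' R R' eS eR; apply: PhiP => //; apply: feq_cons2.
  have inv2 : invariant_on2 (fun S R => Phi S (RNode K :: R)).
    by move=> S S' R R' eS eR; apply: PhiP => //; apply: feq_cons2.
  rewrite !sum_spl_cons !big_split; congr (_ + _).
    rewrite [LHS](IHF _ inv1); apply: eq_bigr => p _.
    by apply: PhiP (feq_refl _); apply: feq_head.
  rewrite [LHS](IHF _ inv2); apply: eq_bigr => p _.
  by apply: PhiP; [apply: feq_refl|apply: feq_head].
- have expand v w : \sum_(p <- spl [:: v, w & F]) Phi p.1 p.2
      = \sum_(p <- spl F) (Phi [:: v, w & p.1] p.2 + Phi (v :: p.1) (w :: p.2)
                          + (Phi (w :: p.1) (v :: p.2) + Phi p.1 [:: v, w & p.2])).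
    rewrite sum_spl_cons.
    rewrite (sum_spl_cons _ _ (fun S R => Phi (v :: S) R + Phi S (v :: R))).
    by rewrite !big_split /=; abel.
  rewrite !expand !big_split /=.
  have e1 : \sum_(i <- spl F) Phi [:: t, u & i.1] i.2
          = \sum_(i <- spl F) Phi [:: u, t & i.1] i.2.
    by apply: eq_bigr => p _; apply: PhiP; [apply: feq_swap|apply: feq_refl].
  have e2 : \sum_(i <- spl F) Phi i.1 [:: t, u & i.2]
          = \sum_(i <- spl F) Phi i.1 [:: u, t & i.2].
    by apply: eq_bigr => p _; apply: PhiP; [apply: feq_refl|apply: feq_swap].
  by rewrite e1 e2; abel.
- by rewrite IH1 // IH2.
Qed.

Lemma sum_sf_feq Phi F F' : invariant_on2 Phi -> feq F F' ->
  \sum_(p <- sf F) Phi p.1 p.2 = \sum_(p <- sf F') Phi p.1 p.2.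
Proof.
move=> PhiP FF'; elim: FF' Phi PhiP
  => {F F'} [|K K' F F' KK' IHK FF' IHF|[K] [K'] F|F G H _ IH1 _ IH2] Phi PhiP.
- by [].
- have inv1 : invariant_on2 (fun S R => Phi S (RNode R :: F)).
    by move=> S S' R R' eS eR; apply: PhiP => //; apply: feq_head.
  have inv2 : invariant_on2 (fun S R => Phi S (RNode K :: R)).
    by move=> S S' R R' eS eR; apply: PhiP => //; apply: feq_cons2.
  rewrite !sum_sf_cons; congr (_ + _).
    rewrite (sum_sk _ (fun S R => Phi S (RNode R :: F))) (sum_spl_feq inv1 KK').
    rewrite [X in _ + X](IHK _ inv1) -(sum_sk _ (fun S R => Phi S (RNode R :: F))).
    by apply: eq_bigr => p _; apply: PhiP; [apply: feq_refl|apply: feq_cons2].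
  rewrite [LHS](IHF _ inv2); apply: eq_bigr => p _; apply: PhiP; first exact: feq_refl.
  exact: feq_head.
- rewrite !sum_sf_cons !(sum_sf_cons _ _ (fun S R => Phi S (_ :: R))) addrCA.
  by congr (_ + (_ + _)); apply: eq_bigr => p _;
    (apply: PhiP; [apply: feq_refl|apply: feq_swap]).
- by rewrite IH1 // IH2.
Qed.

Lemma sum_spl_nil1 K Phi :
  \sum_(p <- spl K | nilp p.1) Phi p.1 p.2 = Phi [::] K.
Proof.
elim: K Phi => [|u K IHK] Phi; first by rewrite big_cons big_nil addr0.
rewrite /= big_cat !big_map /= big_pred0_eq add0r.
exact: IHK (fun S R => Phi S (u :: R)).
Qed.

(** The empty set of subtrees can be detached at each of the [fweight F] vertices. *)
Lemma sum_sf_nil1 F Phi :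
  \sum_(p <- sf F | nilp p.1) Phi p.1 p.2 = Phi [::] F *+ fweight F.
Proof.
elim/forest_ind: F Phi => [|K F IHK IHF] Phi; first by rewrite big_nil.
rewrite sf_cons big_cat !big_map skE big_cat /=.
rewrite (sum_spl_nil1 _ (fun S R => Phi S (RNode R :: F))).
rewrite (IHK (fun S R => Phi S (RNode R :: F))) (IHF (fun S R => Phi S (RNode K :: R))).
by rewrite fweight_cons weightE mulrnDr mulrS.
Qed.

Lemma sum_sk_nil1 K Phi :
  \sum_(p <- sk K | nilp p.1) Phi p.1 p.2 = Phi [::] K *+ (fweight K).+1.
Proof. by rewrite skE big_cat sum_spl_nil1 sum_sf_nil1 mulrS. Qed.

End Splittings.

(** * Action of the enveloping algebra *)

Definition scalar_linear (V W : lmodType rat) (h : V -> W) :=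
  forall a x y, h (a *: x + y) = a *: h x + h y.

Section ScalarLinear.

Variables (V W : lmodType rat) (h : V -> W).
Hypothesis hL : scalar_linear h.

Lemma slD x y : h (x + y) = h x + h y.
Proof. by rewrite -[x]scale1r hL !scale1r. Qed.

Lemma sl0 : h 0 = 0.
Proof. by apply: (@addrI _ (h 0)); rewrite -slD !addr0. Qed.

Lemma slZ a x : h (a *: x) = a *: h x.
Proof. by rewrite -[a *: x]addr0 hL sl0 addr0. Qed.

Lemma slN x : h (- x) = - h x.
Proof. by rewrite -scaleN1r slZ scaleN1r. Qed.

Lemma slB x y : h (x - y) = h x - h y.
Proof. by rewrite slD slN. Qed.

Lemma sl_sum I (s : seq I) (P : pred I) (f : I -> V) :
  h (\sum_(i <- s | P i) f i) = \sum_(i <- s | P i) h (f i).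
Proof. exact: (big_morph h slD sl0). Qed.

End ScalarLinear.

Section EnvelopingAction.

Variable V : lmodType rat.
Implicit Types (g : forest -> V -> V) (m : V).

(** The fuel [n] is meant to bound the weight of [F], and detached parts are strictly lighter. With
    such fuel, 0 is met only at the empty forest, which acts as the identity. *)
Fixpoint rhon g n F m : V :=
  match n with
  | 0 => m
  | n'.+1 => if nilp F then m
             else \sum_(p <- sf F) rhon g n' p.1 (gh (g^~ m) p.2)
  end.

(* The action on [V] of the forest [F], seen as an element of the enveloping
   algebra, for which [gh g] gives the part ending in a single generator. *)
Definition rho g F m := rhon g (fweight F) F m.

Lemma sf_weight_lt F p : p \in sf F ->
  (fweight p.1 < fweight F)%N /\ (fweight p.2 <= fweight F)%N.
Proof.
move/sf_weight => [p2 ->]; rewrite leq_addl -[ltnLHS]addn0 ltn_add2l lt0n.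
by rewrite fweight_eq0; case: p.2 p2.
Qed.

Lemma rhon_local g g' n n' F m :
  (forall K x, (fweight K < fweight F)%N -> g K x = g' K x) ->
  (fweight F <= n)%N -> (fweight F <= n')%N -> rhon g n F m = rhon g' n' F m.
Proof.
elim: n n' F m => [|n IHn] [|n'] F m gg' Fn Fn' //=.
- by move: Fn; rewrite leqn0 fweight_eq0 => ->.
- by move: Fn'; rewrite leqn0 fweight_eq0 => ->.
case: ifP => // _; rewrite !big_seq; apply: eq_bigr => p /sf_weight_lt[w1 w2].
rewrite (@gh_local _ (g^~ m) (g'^~ m)); last first.
  by move=> K wK; apply: gg'; rewrite wK.
apply: IHn.
- by move=> K x wK; apply: gg'; apply: ltn_trans w1.
- by rewrite -ltnS (leq_trans w1).
- by rewrite -ltnS (leq_trans w1).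
Qed.

Lemma rho_local g g' F m :
  (forall K x, (fweight K < fweight F)%N -> g K x = g' K x) ->
  rho g F m = rho g' F m.
Proof. by move=> gg'; apply: rhon_local. Qed.

Lemma rho_nil g m : rho g [::] m = m. Proof. by []. Qed.

Lemma rho_unfold g F m : F != [::] ->
  rho g F m = \sum_(p <- sf F) rho g p.1 (gh (g^~ m) p.2).
Proof.
move=> F0; rewrite /rho; case wF: (fweight F) => [|n].
  by move/eqP: wF; rewrite fweight_eq0; case: F F0.
rewrite /=; have -> : nilp F = false by case: F F0 {wF}.
rewrite !big_seq; apply: eq_bigr => p /sf_weight_lt[w1 _].
by apply: rhon_local => //; rewrite -ltnS -wF.
Qed.

Lemma rho_tree g K m :
  rho g [:: RNode K] m = \sum_(p <- sk K) rho g p.1 (g p.2 m).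
Proof. by rewrite rho_unfold // sf_cons big_cat big_map /= big_nil addr0. Qed.

Lemma rho_tree_top g K m : rho g [:: RNode K] m =
  g K m *+ (fweight K).+1
  + \sum_(p <- sk K | ~~ nilp p.1) rho g p.1 (g p.2 m).
Proof.
rewrite rho_tree (bigID (fun p => nilp p.1)) /=.
by rewrite (sum_sk_nil1 _ (fun S R => rho g S (g R m))).
Qed.

Variable g : forest -> V -> V.
Hypothesis g_linear : forall K, scalar_linear (g K).

Lemma rho_linear F : scalar_linear (rho g F).
Proof.
move: {2}(fweight F) (leqnn (fweight F)) => n; elim: n F => [|n IHn] F wF a x y.
  by move: wF; rewrite leqn0 fweight_eq0 => /nilP ->.
have [->//|F0] := eqVneq F [::].
rewrite !rho_unfold // scaler_sumr -big_split /= !big_seq.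
apply: eq_bigr => p /sf_weight_lt[w1 _].
rewrite (@gh_linear _ a _ (g^~ x) (g^~ y)) => [|K]; last exact: g_linear.
by apply: IHn; rewrite -ltnS (leq_trans w1).
Qed.

(** Two of the three families in [sum_sf_star] evaluate [gh] on a product of a tree with a nonempty
    forest and vanish by [gh_star]. In the third, [T] multiplies the detached part, which is lighter
    than [G], and induction applies. *)
Lemma rho_star T G m :
  \sum_(H <- star (RNode T) G) rho g H m = rho g [:: RNode T] (rho g G m).
Proof.
move: {2}(fweight G) (leqnn (fweight G)) => n; elim: n G m => [|n IHn] G m wG.
  move: wG; rewrite leqn0 fweight_eq0 => /nilP ->.
  by rewrite sum_star sum_gf_nil addr0 rho_nil.
have [->|G0] := eqVneq G [::].
  by rewrite sum_star sum_gf_nil addr0 rho_nil.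
transitivity (\sum_(H <- star (RNode T) G) \sum_(p <- sf H)
    rho g p.1 (gh (g^~ m) p.2)).
  rewrite !big_seq; apply: eq_bigr => H /star_neq0 H0.
  by rewrite rho_unfold.
rewrite (sum_sf_star _ _ (fun S R => rho g S (gh (g^~ m) R))).
rewrite big_split /= [X in _ + X + _]big_seq [X in _ + X + _]big1 ?addr0; last first.
  move=> p /sf_weight[p2 _].
  by rewrite -(sl_sum (@rho_linear _)) gh_star // (sl0 (@rho_linear _)).
rewrite [X in _ + X]big1 ?addr0; last first.
  by move=> p _; rewrite -(sl_sum (@rho_linear _)) gh_star // (sl0 (@rho_linear _)).
rewrite (rho_unfold _ _ G0) (sl_sum (@rho_linear _)) !big_seq.
apply: eq_bigr => p /sf_weight_lt[w1 _]; apply: IHn.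
by rewrite -ltnS (leq_trans w1).
Qed.

Hypothesis g_invariant : forall m, invariant_on (g^~ m).
Hypothesis g_bracket : forall m, kills_brackets (g^~ m).

Lemma rho_invariant m : invariant_on (fun F => rho g F m).
Proof.
move=> F; move: {2}(fweight F) (leqnn (fweight F)) => n.
elim: n m F => [|n IHn] m F wF G FG.
  move: wF (feq_size FG); rewrite leqn0 fweight_eq0 => /nilP ->.
  by case: G FG.
have [F0|F0] := eqVneq F [::].
  by move: (feq_size FG); rewrite F0; case: G {FG}.
have G0 : G != [::] by apply: contraNneq F0 => G0; move: (feq_size FG); rewrite G0; case: F {wF FG}.
rewrite !rho_unfold //.
(* The summands are only known to be invariant below the weight of [F], so
   they are cut off to apply [sum_sf_feq]. *)
pose Phi S R := if (fweight S <= n)%N then rho g S (gh (g^~ m) R) else 0.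
have cutoff H : (fweight H <= n.+1)%N ->
    \sum_(p <- sf H) rho g p.1 (gh (g^~ m) p.2) = \sum_(p <- sf H) Phi p.1 p.2.
  move=> wH; rewrite !big_seq; apply: eq_bigr => p /sf_weight_lt[w1 _].
  by rewrite /Phi -ltnS (leq_trans w1).
rewrite !cutoff -?(feq_fweight FG) //; apply: sum_sf_feq => // S S' R R' SS' RR'.
rewrite /Phi -(feq_fweight SS'); case: ifP => // wS.
by rewrite (gh_invariant (g_invariant m) (g_bracket m) RR'); apply: IHn.
Qed.

(** By [rho_star] a composite of two trees is their juxtaposition plus the graftings; by invariance
    the juxtapositions cancel in the commutator. *)
Lemma rho_bracket T T' m :
  \sum_(X <- star (RNode T) T') rho g [:: RNode X] m
  - \sum_(X <- star (RNode T') T) rho g [:: RNode X] m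
  = rho g [:: RNode T] (rho g [:: RNode T'] m)
    - rho g [:: RNode T'] (rho g [:: RNode T] m).
Proof.
have expand A B : rho g [:: RNode A] (rho g [:: RNode B] m)
  = rho g [:: RNode A; RNode B] m + \sum_(X <- star (RNode A) B) rho g [:: RNode X] m.
  by rewrite -rho_star sum_star sum_gf_cons sum_gf_nil addr0.
rewrite !expand (@rho_invariant m [:: RNode T'; RNode T] [:: RNode T; RNode T']).
  by rewrite opprD addrACA subrr add0r.
exact: feq_swap.
Qed.

End EnvelopingAction.

(** * Cuts are adjoint to graftings *)

Fixpoint sel G : seq (rtree * forest) :=
  match G with
  | [::] => [::]
  | c :: G' => (c, G') :: [seq (p.1, c :: p.2) | p <- sel G']
  end.

Lemma sel_feq G p : p \in sel G -> feq (p.1 :: p.2) G.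
Proof.
elim: G p => [|c G IHG] p //=; rewrite inE => /orP[/eqP ->|/mapP[q /IHG qG ->]].
  exact: feq_refl.
exact: feq_trans (feq_swap _ _ _) (feq_cons2 _ qG).
Qed.

Section Selections.

Variable V : zmodType.

Lemma sum_sel_cons c G (Phi : rtree -> forest -> V) :
  \sum_(p <- sel (c :: G)) Phi p.1 p.2
  = Phi c G + \sum_(p <- sel G) Phi p.1 (c :: p.2).
Proof. by rewrite /= big_cons big_map. Qed.

Lemma sum_sel2C G (f : rtree -> rtree -> forest -> V) :
  \sum_(p <- sel G) \sum_(q <- sel p.2) f p.1 q.1 q.2
  = \sum_(p <- sel G) \sum_(q <- sel p.2) f q.1 p.1 q.2.
Proof.
elim: G f => [|c G IHG] f; first by rewrite !big_nil.
have expand (h : rtree -> rtree -> forest -> V) :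
  \sum_(p <- sel (c :: G)) \sum_(q <- sel p.2) h p.1 q.1 q.2
  = \sum_(q <- sel G) h c q.1 q.2 + \sum_(q <- sel G) h q.1 c q.2
    + \sum_(p <- sel G) \sum_(q <- sel p.2) h p.1 q.1 (c :: q.2).
  rewrite (sum_sel_cons _ _ (fun a b => \sum_(q <- sel b) h a q.1 q.2)) -addrA.
  congr (_ + _); rewrite -big_split; apply: eq_bigr => p _.
  by rewrite (sum_sel_cons _ _ (h p.1)).
rewrite expand (expand (fun a b => f b a)); congr (_ + _); first exact: addrC.
exact: IHG (fun a b C => f a b (c :: C)).
Qed.

Lemma sum_sel_feq (Phi : rtree -> forest -> V) G G' :
  (forall K K' F F', feq K K' -> feq F F' -> Phi (RNode K) F = Phi (RNode K') F') ->
  feq G G' -> \sum_(p <- sel G) Phi p.1 p.2 = \sum_(p <- sel G') Phi p.1 p.2.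
Proof.
move=> PhiP GG'; elim: GG' Phi PhiP
  => {G G'} [|K K' F F' KK' IHK FF' IHF|[K] [K'] F|F G H _ IH1 _ IH2] Phi PhiP //.
- rewrite !sum_sel_cons (PhiP _ _ _ _ KK' FF'); congr (_ + _).
  rewrite (IHF (fun a b => Phi a (RNode K :: b))).
    apply: eq_bigr => -[[L] p] _.
    by apply: PhiP; [apply: feq_refl|apply: feq_head].
  by move=> *; apply: PhiP => //; apply: feq_cons2.
- rewrite !sum_sel_cons !(sum_sel_cons _ _ (fun a b => Phi a (_ :: b))) addrCA.
  congr (_ + (_ + _)); apply: eq_bigr => -[[L] p] _.
  by apply: PhiP; [apply: feq_refl|apply: feq_swap].
- by rewrite IH1 // IH2.
Qed.

End Selections.

(* [pt t u] is the number of isomorphisms from [t] to [u]. *)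
Fixpoint pt t u {struct t} : rat :=
  let: RNode F := t in
  (fix pf F G {struct F} : rat := match F with
     | [::] => (nilp G)%:R
     | c :: F' => \sum_(p <- sel G) pt c p.1 * pf F' p.2
     end) F (children u).
Definition pf := fix pf F G {struct F} : rat := match F with
     | [::] => (nilp G)%:R
     | c :: F' => \sum_(p <- sel G) pt c p.1 * pf F' p.2
     end.

Lemma ptE F G : pt (RNode F) (RNode G) = pf F G. Proof. by []. Qed.
Lemma pt_RNode F u : pt (RNode F) u = pf F (children u). Proof. by []. Qed.
Lemma pf_nil G : pf [::] G = (nilp G)%:R. Proof. by []. Qed.
Lemma pf_cons c F G : pf (c :: F) G = \sum_(p <- sel G) pt c p.1 * pf F p.2.
Proof. by []. Qed.

Lemma pf_feqr F G G' : feq G G' -> pf F G = pf F G'.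
Proof.
elim/forest_ind: F G G' => [|K F IHK IHF] G G' GG'.
  by move: (feq_size GG'); rewrite !pf_nil; case: G {GG'} => [|? ?]; case: G'.
rewrite !pf_cons; apply: (sum_sel_feq (Phi := fun a b => pt _ a * pf F b)) => //.
by move=> L L' H H' LL' HH'; rewrite !ptE (IHK _ _ LL') (IHF _ _ HH').
Qed.

Lemma pf_feql F F' G : feq F F' -> pf F G = pf F' G.
Proof.
move=> FF'; elim: FF' G => {F F'} [|K K' F F' _ IHK _ IHF|t u F|F F' F'' _ IH1 _ IH2] G.
- by [].
- rewrite !pf_cons; apply: eq_bigr => p _; by rewrite !pt_RNode IHK IHF.
- rewrite !pf_cons.
  under eq_bigr do rewrite pf_cons big_distrr.
  under [RHS]eq_bigr do rewrite pf_cons big_distrr.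
  rewrite /= (sum_sel2C _ (fun a b C => pt t a * (pt u b * pf F C))).
  by do 2![apply: eq_bigr => ? _]; rewrite mulrCA.
- by rewrite IH1.
Qed.

Lemma pf_ge0 F G : 0 <= pf F G.
Proof.
elim/forest_ind: F G => [|K F IHK IHF] G; first by rewrite pf_nil ler0n.
by rewrite pf_cons; apply: sumr_ge0 => p _; rewrite mulr_ge0 // pt_RNode.
Qed.

Lemma pf_gt0 F : 0 < pf F F.
Proof.
elim/forest_ind: F => [|K F IHK IHF]; first by rewrite pf_nil ltr01.
rewrite pf_cons /= big_cons ltr_wpDr //; last by rewrite mulr_gt0.
by apply: sumr_ge0 => p _; rewrite mulr_ge0 ?pf_ge0 // pt_RNode pf_ge0.
Qed.

Lemma pf_neq0 F G : pf F G != 0 -> feq F G.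
Proof.
elim/forest_ind: F G => [|K F IHK IHF] G.
  by rewrite pf_nil; case: G => // _; apply: feq_nil.
rewrite pf_cons => nz.
have /hasP[p pG] : has (fun p => pt (RNode K) p.1 * pf F p.2 != 0) (sel G).
  apply: contra_neqT nz => /hasPn z; rewrite big_seq big1 // => p /z.
  by rewrite negbK => /eqP.
rewrite mulf_eq0 negb_or => /andP[/IHK Kp /IHF Fp].
by apply: feq_trans (sel_feq pG); rewrite -(childrenK p.1); apply: feq_cons.
Qed.

(** The recursion of [cuts] without its prefix accumulator: the root of the second component is left
    out. *)
Fixpoint cf G : seq (rtree * forest) :=
  match G with
  | [::] => [::]
  | c :: G' => (c, G') :: [seq (p.1, p.2 :: G') | p <- cuts c]
               ++ [seq (p.1, c :: p.2) | p <- cf G']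
  end.

Lemma cutsE G : cuts (RNode G) = [seq (p.1, RNode p.2) | p <- cf G].
Proof.
rewrite /=; set go := (fix go (pre l : forest) {struct l} := _).
suff goE pre : go pre G = [seq (p.1, RNode (pre ++ p.2)) | p <- cf G] by exact: goE.
elim: G pre => [|c G IHG] pre //=.
rewrite map_cat -!map_comp IHG; congr (_ :: _ ++ _).
by apply: eq_map => p /=; rewrite cat_rcons.
Qed.

(** Cuts are grouped by the child of the root at or above which the edge lies. That child is moved
    to the front, whence the invariance hypothesis. *)
Lemma sum_cf (V : zmodType) (Phi : rtree -> forest -> V) G :
  (forall p, invariant_on (Phi p)) ->
  \sum_(p <- cf G) Phi p.1 p.2
  = \sum_(q <- sel G) (Phi q.1 q.2 + \sum_(p <- cuts q.1) Phi p.1 (p.2 :: q.2)).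
Proof.
elim: G Phi => [|c G IHG] Phi PhiP; first by rewrite !big_nil.
rewrite /= !big_cons big_cat !big_map /= -addrA; congr (_ + (_ + _)).
rewrite (IHG (fun a b => Phi a (c :: b))) => [|p]; last exact: invariant_cons.
apply: eq_bigr => q _; congr (_ + _); apply: eq_bigr => p _.
exact/PhiP/feq_swap.
Qed.

Lemma pf_gf t F G : \sum_(H <- gf t F) pf H G
  = \sum_(q <- sel G) \sum_(p <- cuts q.1) pt t p.1 * pf F (p.2 :: q.2).
Proof.
elim/forest_ind: F G => [|K F IHK IHF] G.
  rewrite sum_gf_nil big1 // => q _; rewrite big1 // => p _.
  by rewrite pf_nil mulr0.
have starK C : \sum_(H <- star t K) pf H C = \sum_(p <- cf C) pt t p.1 * pf K p.2.
  rewrite (sum_cf (Phi := fun p R => pt t p * pf K R)) => [|p R R' RR'].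
    by rewrite big_split /= -IHK sum_star.
  by rewrite (pf_feqr _ RR').
rewrite sum_gf_cons.
have -> : \sum_(K' <- star t K) pf (RNode K' :: F) G
   = \sum_(q <- sel G) \sum_(p <- cuts q.1) pt t p.1 * (pt (RNode K) p.2 * pf F q.2).
  rewrite exchange_big; apply: eq_bigr => q _ /=.
  rewrite -big_distrl /= (eq_bigr _ (fun K' _ => pt_RNode K' q.1)) starK.
  rewrite -{2}(childrenK q.1) cutsE big_map big_distrl; apply: eq_bigr => p _ /=.
  by rewrite mulrA.
have -> : \sum_(F' <- gf t F) pf (RNode K :: F') G
   = \sum_(q <- sel G) \sum_(r <- sel q.2) \sum_(p <- cuts q.1)
       pt t p.1 * (pt (RNode K) r.1 * pf F (p.2 :: r.2)).
  rewrite exchange_big.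
  rewrite [RHS](sum_sel2C _ (fun a b C => \sum_(p <- cuts a)
       pt t p.1 * (pt (RNode K) b * pf F (p.2 :: C)))).
  apply: eq_bigr => q _; rewrite -big_distrr /= IHF big_distrr /=.
  apply: eq_bigr => r _; rewrite big_distrr /=; apply: eq_bigr => p _.
  exact: mulrCA.
rewrite -big_split; apply: eq_bigr => q _ /=.
rewrite exchange_big -big_split; apply: eq_bigr => p _ /=.
by rewrite big_cons big_map -big_distrr -mulrDr.
Qed.

(** An isomorphism from a grafting of [t] on [RNode F] to [u] sends the new edge to an edge of [u],
    and restricts to isomorphisms onto the two components left by cutting it; conversely such data
    glue. *)
Lemma pt_star t F u : \sum_(H <- star t F) pt (RNode H) u
  = \sum_(p <- cuts u) pt t p.1 * pt (RNode F) p.2.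
Proof.
case: u => G; rewrite cutsE big_map.
rewrite (sum_cf (Phi := fun p R => pt t p * pf F R)) => [|p R R' RR'].
  by rewrite big_split /= -pf_gf -(sum_star t F (pf^~ G)).
by rewrite (pf_feqr _ RR').
Qed.

(** * The Lie algebra of rooted trees *)

Lemma is_lie_span (V : lmodType rat) (br : V -> V -> V) (I : Type) (b : I -> V) :
  (forall y, scalar_linear (br^~ y)) -> (forall x, scalar_linear (br x)) ->
  (forall P : V -> Prop, P 0 -> (forall a x y, P x -> P y -> P (a *: x + y)) ->
     (forall i, P (b i)) -> forall x, P x) ->
  (forall i j, br (b i) (b j) = - br (b j) (b i)) ->
  (forall i j k, br (b i) (br (b j) (b k)) + br (b j) (br (b k) (b i))
                 + br (b k) (br (b i) (b j)) = 0) ->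
  is_lie br.
Proof.
move=> brl brr b_ind banti bjac.
have anti x y : br x y = - br y x.
  elim/b_ind: x => [|a u v eu ev|i].
  - by rewrite (sl0 (brl y)) (sl0 (brr y)) oppr0.
  - by rewrite (brl y) brr eu ev scalerN -opprD.
  elim/b_ind: y => [|a u v eu ev|j] //.
  - by rewrite (sl0 (brl _)) (sl0 (brr _)) oppr0.
  - by rewrite (brl _) brr eu ev scalerN -opprD.
split.
- by move=> a x y z; apply: brl.
- by move=> a x y z; apply: brr.
(* Antisymmetry gives twice [br x x] equal to 0, and 2 is invertible in [rat]. *)
- move=> x; have /eqP := anti x x; rewrite -addr_eq0 -mulr2n -scaler_nat.
  by rewrite scaler_eq0 pnatr_eq0 => /eqP.
pose J x y z := br x (br y z) + br y (br z x) + br z (br x y).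
have J0 y z : J 0 y z = 0.
  by rewrite /J (sl0 (brl _)) (sl0 (brr _)) (sl0 (brr _)) (sl0 (brl _)) (sl0 (brr _)) !addr0.
have JL a x x' y z : J (a *: x + x') y z = a *: J x y z + J x' y z.
  by rewrite /J !(brl _, brr _) !scalerDr; abel.
have JC x y z : J x y z = J y z x by rewrite /J; abel.
have J_ind y z : (forall i, J (b i) y z = 0) -> forall x, J x y z = 0.
  move=> bJ; elim/b_ind => [|a u v eu ev|i]; first exact: J0.
    by rewrite JL eu ev scaler0 addr0.
  exact: bJ.
(* Linearity is known in the first argument only; cyclic rotation brings each argument there in
   turn. *)
move=> x y z; apply: (J_ind) => i; rewrite JC; apply: (J_ind) => j.
rewrite JC; apply: (J_ind) => k; exact: bjac.
Qed.

(** * From the pre-Lie identity to the Jacobi identity *)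

Section PreLie.

Variables (V : lmodType rat) (br : V -> V -> V) (b : rtree -> V).
Hypothesis b_feq : forall F G, feq F G -> b (RNode F) = b (RNode G).

Definition gre t u : V := \sum_(x <- gr t u) b x.

Definition root_value F : V := if F is [:: x] then b x else 0.

Lemma root_value_invariant : invariant_on root_value.
Proof.
move=> F G; elim=> [|K K' {}F F' KK' _ FF' _|[?] [?] {}F|{}F {}G H _ -> _ ->] //.
by move: (feq_size FF'); case: F F' {FF'} => [|? ?] [|? ?] //= _; exact: b_feq.
Qed.

Lemma gre_preLie t u v :
  \sum_(x <- gr u v) gre t x + \sum_(x <- gr u t) gre x v
  = \sum_(x <- gr t v) gre u x + \sum_(x <- gr t u) gre x v.
Proof.
case: t u v => [T] [U] [W].
have gf1 (f : forest -> V) A B :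
    \sum_(H <- gf A [:: B]) f H = \sum_(x <- gr A B) f [:: x].
  by rewrite gf_cons cats0 big_map.
have expand A B : \sum_(x <- gr (RNode B) (RNode W)) gre (RNode A) x
    + \sum_(x <- gr (RNode B) (RNode A)) gre x (RNode W)
    = gf_gf root_value A B [:: RNode W].
  rewrite /gf_gf gf1 -(sum_gr _ _ (fun x => \sum_(H <- gf x [:: RNode W]) root_value H)).
  by congr (_ + _); apply: eq_bigr => x _; rewrite gf1.
by rewrite !expand; apply/gf_preLie/root_value_invariant.
Qed.

Hypotheses (brl : forall y, scalar_linear (br^~ y)) (brr : forall x, scalar_linear (br x)).
Hypothesis b_ind : forall P : V -> Prop, P 0 ->
  (forall a x y, P x -> P y -> P (a *: x + y)) ->
  (forall F, P (b (RNode F))) -> forall x, P x.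
Hypothesis br_b : forall t u, br (b t) (b u) = gre t u - gre u t.

Lemma is_lie_graftings : is_lie br.
Proof.
apply: (@is_lie_span _ _ _ (fun F => b (RNode F)) brl brr b_ind).
  by move=> F G; rewrite !br_b opprB.
have jac t u v : br (b t) (br (b u) (b v)) =
    \sum_(x <- gr u v) gre t x - \sum_(x <- gr u v) gre x t
    - (\sum_(x <- gr v u) gre t x - \sum_(x <- gr v u) gre x t).
  rewrite (br_b u v) (slB (brr _)) /gre !(sl_sum (brr _)) -!sumrB.
  by congr (_ - _); apply: eq_bigr => x _; rewrite br_b.
(* The Jacobi sum has twelve terms, which regroup into three instances of the pre-Lie identity. *)
have solve (A1 A2 A3 A4 A5 A6 B1 B2 B3 B4 B5 B6 : V) :
  A1 + B1 = A4 + B4 -> A2 + B2 = A5 + B5 -> A3 + B3 = A6 + B6 ->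
  A1 - B5 - (A6 - B2) + (A2 - B6 - (A4 - B3)) + (A3 - B4 - (A5 - B1)) = 0.
  move=> e1 e2 e3.
  have -> : A1 - B5 - (A6 - B2) + (A2 - B6 - (A4 - B3)) + (A3 - B4 - (A5 - B1))
     = (A1 + B1 - (A4 + B4)) + (A2 + B2 - (A5 + B5)) + (A3 + B3 - (A6 + B6)).
    by rewrite !opprD !opprK; abel.
  by rewrite e1 e2 e3 !subrr !addr0.
move=> F G H; rewrite !jac; apply: solve.
- exact: gre_preLie.
- exact: gre_preLie.
- exact: gre_preLie.
Qed.

End PreLie.

(** * Isomorphism classes and the basis rescaled by automorphism orders *)

Definition cls t : ctree := exist _ (canon t) (introT eqP (canon_idem t)).

Lemma val_cls t : val (cls t) = canon t. Proof. by []. Qed.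

Lemma valK_cls (c : ctree) : cls (val c) = c.
Proof. by apply: val_inj; rewrite val_cls; apply/eqP/(valP c). Qed.

Lemma cls_feq F G : feq F G -> cls (RNode F) = cls (RNode G).
Proof. by move=> FG; apply: val_inj; rewrite !val_cls; apply: feq_canon. Qed.

Lemma feq_cls F G : cls (RNode F) = cls (RNode G) -> feq F G.
Proof. by move=> eqc; apply: canonP; rewrite -!val_cls eqc. Qed.

(* The order of the automorphism group of [t]. *)
Definition sig t : rat := pt t t.

Lemma sig_neq0 t : sig t != 0.
Proof. by case: t => F; rewrite /sig ptE gt_eqF ?pf_gt0. Qed.

Lemma ptE_sig t u : pt t u = sig t * (cls t == cls u)%:R.
Proof.
case: t u => [F] [G]; rewrite /sig !ptE; case: eqP => [/feq_cls FG|nFG].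
  by rewrite mulr1 -(pf_feqr _ FG).
rewrite mulr0; apply: contra_not_eq nFG => /pf_neq0; exact: cls_feq.
Qed.

Lemma mcoeff_Z (c d : ctree) : (Z c)@_d = (c == d)%:R.
Proof. exact: mcoeffU. Qed.

Lemma mcoeff_scale (a : rat) (x : L1) c : (a *: x)@_c = a * x@_c.
Proof. exact: mcoeffZ. Qed.

Lemma mcoeff_sum I (s : seq I) (P : pred I) (f : I -> L1) c :
  (\sum_(i <- s | P i) f i)@_c = \sum_(i <- s | P i) ((f i)@_c : rat) :> rat.
Proof. exact: raddf_sum. Qed.

Lemma L1P (x y : L1) : (forall c, x@_c = y@_c) -> x = y.
Proof. by move=> xy; apply/malgP. Qed.

Definition e t : L1 := sig t *: Z (cls t).

Lemma sig_feq F G : feq F G -> sig (RNode F) = sig (RNode G).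
Proof. by move=> FG; rewrite /sig !ptE (pf_feql _ FG) (pf_feqr _ FG). Qed.

Lemma e_feq F G : feq F G -> e (RNode F) = e (RNode G).
Proof. by move=> FG; rewrite /e (cls_feq FG) (sig_feq FG). Qed.

Lemma Z_e (c : ctree) : Z c = (sig (val c))^-1 *: e (val c).
Proof. by rewrite /e valK_cls scalerA mulVf ?sig_neq0 ?scale1r. Qed.

Lemma mcoeff_e t (c : ctree) : (e t)@_c = pt t (val c).
Proof. by rewrite ptE_sig valK_cls mcoeff_scale mcoeff_Z. Qed.

Section LinearExtension.

Variable V : lmodType rat.
Implicit Types f : ctree -> V.

Definition lin f (x : L1) : V := \sum_(c <- finmap.enum_fset (msupp x)) x@_c *: f c.

Lemma linEw f (s : seq ctree) x : uniq s -> {subset finmap.enum_fset (msupp x) <= s} ->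
  lin f x = \sum_(c <- s) x@_c *: f c.
Proof.
move=> us sub; rewrite [RHS](bigID (fun c => c \in msupp x)) /=.
rewrite [X in _ = _ + X]big1 ?addr0; last first.
  by move=> c /mcoeff_outdom ->; rewrite scale0r.
rewrite -big_filter; apply: perm_big; apply: uniq_perm.
- exact: finmap.fset_uniq.
- exact: filter_uniq.
move=> c; rewrite mem_filter; have [cx|ncx] /= := boolP (c \in msupp x).
  by rewrite (sub _ cx).
exact: negbTE.
Qed.

Lemma lin_linear f : scalar_linear (lin f).
Proof.
move=> a x y; pose s := undup (finmap.enum_fset (msupp x) ++ finmap.enum_fset (msupp y)
  ++ finmap.enum_fset (msupp (a *: x + y))).
have sub z : z \in [:: x; y; a *: x + y] -> {subset finmap.enum_fset (msupp z) <= s}.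
  by rewrite !inE => /or3P[] /eqP -> c cz; rewrite mem_undup !mem_cat cz ?orbT.
rewrite !(linEw f (undup_uniq _) (sub _ _)) ?inE ?eqxx ?orbT //.
rewrite scaler_sumr -big_split; apply: eq_bigr => c _.
by rewrite mcoeffD mcoeff_scale scalerDl scalerA.
Qed.

Lemma lin_Z f c : lin f (Z c) = f c.
Proof.
rewrite (@linEw _ [:: c]) // ?big_seq1 ?mcoeff_Z ?eqxx ?scale1r //.
by move=> d; rewrite inE -(mcoeff_neq0 (Z c)) mcoeff_Z; case: (eqVneq c d).
Qed.

Lemma lin_eq f f' x : (forall c, c \in msupp x -> f c = f' c) -> lin f x = lin f' x.
Proof. by move=> ff'; rewrite /lin; apply: eq_big_seq => c /ff' ->. Qed.

End LinearExtension.

Lemma L1_sum (x : L1) : x = \sum_(c <- finmap.enum_fset (msupp x)) x@_c *: Z c.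
Proof.
have coef c k : (x@_c *: Z c)@_k = x@_c * (c == k)%:R.
  by rewrite -mcoeff_Z; exact: mcoeff_scale.
apply: L1P => k; rewrite mcoeff_sum (eq_bigr _ (fun c _ => coef c k)).
have [kx|kx] := boolP (k \in msupp x).
  rewrite (bigD1_seq k) ?finmap.fset_uniq //= eqxx mulr1 big1 ?addr0 //.
  by move=> c /negbTE ->; rewrite mulr0.
rewrite mcoeff_outdom // big1_seq // => c /andP[_ cx].
case: eqP => [ck|_]; last by rewrite mulr0.
by rewrite -ck [c \in _]cx in kx.
Qed.

Lemma lin_unique (V : lmodType rat) (h : L1 -> V) :
  scalar_linear h -> forall x, h x = lin (fun c => h (Z c)) x.
Proof.
move=> hL x; rewrite {1}(L1_sum x) (sl_sum hL); apply: eq_bigr => c _.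
exact: slZ.
Qed.

Lemma L1_ind (P : L1 -> Prop) : P 0 -> (forall a x y, P x -> P y -> P (a *: x + y)) ->
  (forall F, P (e (RNode F))) -> forall x, P x.
Proof.
move=> P0 PD Pe x; rewrite (L1_sum x); apply: (big_rec P) => // c y _ Py.
by apply: (PD) => //; rewrite Z_e -[_ *: _]addr0 -(childrenK (val c)); apply: PD.
Qed.

Local Open Scope classical_set_scope.

Definition tri (c d : ctree) : L1 :=
  (\sum_(t \in [set: ctree]) (ncut c d t)%:R *: Z t)%R.

Local Close Scope classical_set_scope.

(** In [pt_star] each number of isomorphisms is an automorphism order times an indicator, so the
    cuts of the right type are counted. This turns [ncut] into the structure constants of grafting
    in the basis [e]. *)
Lemma ncut_star t F (c : ctree) :
  sig t * sig (RNode F) * (ncut (cls t) (cls (RNode F)) c)%:R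
  = \sum_(x <- gr t (RNode F)) pt x (val c).
Proof.
rewrite sum_gr pt_star /ncut -sum1_count big_mkcond raddf_sum mulr_sumr.
apply: eq_bigr => p _; rewrite !ptE_sig mulrACA -natrM mulnb.
have iso q v : tree_iso q (val (cls v)) = (cls v == cls q).
  by rewrite /tree_iso val_cls canon_idem eq_sym -!val_cls val_eqE.
by rewrite !iso; case: ifP.
Qed.

Lemma tri_e t F : (sig t * sig (RNode F)) *: tri (cls t) (cls (RNode F))
  = \sum_(x <- gr t (RNode F)) e x.
Proof.
have nz : sig t * sig (RNode F) != 0 by rewrite mulf_neq0 ?sig_neq0.
(* The sum in [tri] runs over all classes; by [ncut_star] it is supported on the finitely many
   classes of graftings, since the factors [sig] are nonzero. *)
have [r ur out] : exists2 r : seq ctree, uniq r &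
    forall c, c \notin r -> ncut (cls t) (cls (RNode F)) c = 0%N.
  exists (undup (map cls (gr t (RNode F)))) => [|c]; first exact: undup_uniq.
  rewrite mem_undup => nc; apply/eqP; rewrite -(eqr_nat rat); apply/eqP/(mulfI nz).
  rewrite ncut_star mulr0 big_seq big1 // => x xg; rewrite ptE_sig valK_cls.
  case: eqP => [xc|_]; last by rewrite mulr0.
  by rewrite -xc map_f in nc.
rewrite /tri (fsbigE r) //; last by move=> c _ /out ->; rewrite scale0r.
rewrite (eq_bigl xpredT) => [|c]; last exact: classical_sets.in_setT.
apply: L1P => c; rewrite mcoeff_scale [in RHS]mcoeff_sum.
rewrite (eq_bigr _ (fun x _ => mcoeff_e x c)) -ncut_star; congr (_ * _).
transitivity (\sum_(d <- r) (ncut (cls t) (cls (RNode F)) d)%:R * (d == c)%:R : rat).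
  by rewrite mcoeff_sum; apply: eq_bigr => d _; rewrite mcoeff_scale mcoeff_Z.
have [cr|/[dup] ncr /out ->] := boolP (c \in r).
  rewrite (bigD1_seq c) //= eqxx mulr1 big1 ?addr0 //.
  by move=> d /negbTE ->; rewrite mulr0.
rewrite big1_seq // => d /andP[_ dr]; case: eqP => [dc|_]; last by rewrite mulr0.
by rewrite -dc dr in ncr.
Qed.

Lemma br1E x y : br1 x y = lin (fun c => lin (br_basis c) y) x.
Proof.
apply: eq_bigr => c _; rewrite scaler_sumr; apply: eq_bigr => d _.
by rewrite scalerA.
Qed.

Lemma br1_linearl y : scalar_linear (br1^~ y).
Proof. by move=> a x x'; rewrite !br1E lin_linear. Qed.

Lemma br1_linearr x : scalar_linear (br1 x).
Proof.
move=> a y y'; rewrite !br1E /lin scaler_sumr -big_split; apply: eq_bigr => c _.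
by rewrite -!/(lin _ _) lin_linear scalerDr !scalerA mulrC.
Qed.

Lemma br1_Z c d : br1 (Z c) (Z d) = tri c d - tri d c.
Proof. by rewrite br1E !lin_Z. Qed.

Lemma br1_e t u : br1 (e t) (e u) = \sum_(x <- gr t u) e x - \sum_(x <- gr u t) e x.
Proof.
rewrite (slZ (br1_linearl _)) (slZ (br1_linearr _)) br1_Z scalerA scalerBr.
case: t u => [F] [G]; rewrite -(tri_e (RNode F) G) -(tri_e (RNode G) F).
by rewrite (mulrC (sig (RNode G))).
Qed.

Lemma br1_lie : is_lie br1.
Proof. exact: is_lie_graftings e_feq br1_linearl br1_linearr L1_ind br1_e. Qed.

Lemma sl_ker (V W : lmodType rat) (h : V -> W) : scalar_linear h ->
  forall a x y, h x = 0 -> h (a *: x + y) = h y.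
Proof. by move=> hL a x y hx; rewrite hL hx scaler0 add0r. Qed.

(** * Weights and homogeneous elements *)

Definition wt (c : ctree) : nat := weight (val c).
(** An arbitrary enumeration, which orders the classes of one weight for the choice of
    generators. *)
Definition rank (c : ctree) : nat := choice.pickle (val c).

Lemma rank_inj : injective rank.
Proof. by move=> c d /(pcan_inj choice.pickleK) /val_inj. Qed.

Lemma weight_canon t : weight (canon t) = weight t.
Proof.
case: t => F; rewrite -(childrenK (canon (RNode F))) !weightE.
by rewrite -(feq_fweight (canon_feq F)).
Qed.

Lemma wt_cls t : wt (cls t) = weight t.
Proof. by rewrite /wt val_cls weight_canon. Qed.

Lemma wt_gt0 c : (0 < wt c)%N.
Proof. by rewrite /wt; case: (val c). Qed.

Lemma weight_children c : wt c = (fweight (children (val c))).+1.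
Proof. by rewrite /wt -{1}(childrenK (val c)). Qed.

Lemma weight_gr t u x : x \in gr t u -> weight x = (weight t + weight u)%N.
Proof.
case: u => F; rewrite gr_RNode => /mapP[H /star_weight wH ->].
by rewrite !weightE wH addnS.
Qed.

Definition hom (n : nat) (x : L1) := forall d : ctree, x@_d != 0 -> wt d = n.

Lemma mcoeff_lin_neq0 (f : ctree -> L1) x d :
  (lin f x)@_d != 0 -> exists2 c : ctree, x@_c != 0 & (f c)@_d != 0.
Proof.
move=> nz; apply: boolp.contrapT => H; move/eqP: nz; apply.
rewrite /lin mcoeff_sum big1_seq // => c _; rewrite mcoeff_scale.
have [-> |xc] := eqVneq (x@_c) 0; first by rewrite mul0r.
have [-> |fc] := eqVneq ((f c)@_d) 0; first by rewrite mulr0.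
by case: H; exists c.
Qed.

Lemma lin_eqw (V : lmodType rat) (f g : ctree -> V) (x : L1) :
  (forall c : ctree, x@_c != 0 -> f c = g c) -> lin f x = lin g x.
Proof. by move=> fg; apply: lin_eq => c; rewrite -mcoeff_neq0 => /fg. Qed.

Lemma mcoeff_comb (a : rat) (x y : L1) d : (a *: x + y)@_d = a * x@_d + y@_d.
Proof. by rewrite mcoeffD; congr (_ + _); exact: mcoeff_scale. Qed.

Lemma hom_comb n a x y : hom n x -> hom n y -> hom n (a *: x + y).
Proof.
move=> xn yn d; rewrite mcoeff_comb => nz.
have [x0|/xn//] := eqVneq (x@_d) 0.
by apply: yn; move: nz; rewrite x0 mulr0 add0r.
Qed.

Lemma hom0 n : hom n 0.
Proof. by move=> d; rewrite mcoeff0 eqxx. Qed.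

Lemma hom_Z c : hom (wt c) (Z c).
Proof. by move=> d; rewrite mcoeff_Z; have [->|_] := eqVneq c d; rewrite ?eqxx. Qed.

Lemma hom_e t : hom (weight t) (e t).
Proof.
by rewrite -wt_cls -[e t]addr0; apply: hom_comb; [apply: hom_Z|apply: hom0].
Qed.

Lemma hom_br1_e t u : hom (weight t + weight u) (br1 (e t) (e u)).
Proof.
have hom_gr v w n : n = (weight v + weight w)%N -> hom n (\sum_(x <- gr v w) e x).
  move=> ->; rewrite big_seq; apply: (big_ind (hom _)).
  - exact: hom0.
  - by move=> x y hx hy; rewrite -[x]scale1r; apply: hom_comb.
  - by move=> x /weight_gr <-; apply: hom_e.
rewrite br1_e addrC -scaleN1r; apply: hom_comb; apply: hom_gr => //.
exact: addnC.
Qed.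

Lemma br1_scale a b x y : br1 (a *: x) (b *: y) = (a * b) *: br1 x y.
Proof.
rewrite -scalerA -(slZ (br1_linearr x) b y).
exact: slZ (br1_linearl (b *: y)) a x.
Qed.

Lemma br1_ZE c d : br1 (Z c) (Z d)
  = ((sig (val c))^-1 * (sig (val d))^-1) *: br1 (e (val c)) (e (val d)).
Proof.
exact: etrans (congr2 br1 (Z_e c) (Z_e d)) (br1_scale _ _ _ _).
Qed.

Lemma br1_eE t u : br1 (e t) (e u) = (sig t * sig u) *: br1 (Z (cls t)) (Z (cls u)).
Proof. exact: br1_scale. Qed.

Lemma hom_br1_Z c d : hom (wt c + wt d) (br1 (Z c) (Z d)).
Proof.
rewrite br1_ZE -[_ *: _]addr0; apply: hom_comb; [exact: hom_br1_e|exact: hom0].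
Qed.

(** * Generators and the projection onto their span *)

Inductive Brk (n : nat) : L1 -> Prop :=
| Brk0 : Brk n 0
| BrkS a c d y : (wt c + wt d)%N = n -> Brk n y -> Brk n (a *: br1 (Z c) (Z d) + y).

Lemma Brk_comb n a x y : Brk n x -> Brk n y -> Brk n (a *: x + y).
Proof.
move=> Bx By; elim: Bx => [|b c d z cd _ IH]; first by rewrite scaler0 add0r.
by rewrite scalerDr scalerA -addrA; apply: BrkS.
Qed.

Lemma Brk_hom n x : Brk n x -> hom n x.
Proof.
elim=> [|a c d y cd _ IH]; first exact: hom0.
by apply: hom_comb => //; rewrite -cd; apply: hom_br1_Z.
Qed.

Definition lower c (x : L1) :=
  forall d : ctree, x@_d != 0 -> wt d = wt c /\ (rank d < rank c)%N.

Definition reduces c x := lower c x /\ Brk (wt c) (Z c - x).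

Definition generator c := ~ exists x, reduces c x.

(** Lexicographic induction on weight, then rank: reduction of a non-generator lowers the rank at
    fixed weight, while the brackets involve only lighter classes. *)
Lemma ctree_gen_ind (P : ctree -> Prop) :
  (forall c, generator c -> P c) ->
  (forall c x, (forall d, (wt d < wt c)%N -> P d) ->
     (forall d : ctree, x@_d != 0 -> wt d = wt c /\ P d) ->
     Brk (wt c) (Z c - x) -> P c) ->
  forall c, P c.
Proof.
move=> Pgen Pred c; move: {2}(wt c) (erefl (wt c)) => n.
elim/ltn_ind: n c => n IHn c; move: {2}(rank c) (erefl (rank c)) => r.
elim/ltn_ind: r c => r IHr c rc wc.
have [[x [lx Bx]]|genc] := boolp.pselect (exists x, reduces c x); last exact: Pgen.
apply: (Pred c x) => // [d|d /lx[wd rd]].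
  by rewrite wc => /IHn; apply.
by split=> //; apply: (IHr (rank d)) => //; rewrite -?rc // wd.
Qed.

(** Each reduction lowers the rank, so any fuel above the rank of [c] gives the same value
    ([pin_stable]). *)
Fixpoint pin n c : L1 :=
  match n with
  | 0 => 0
  | n'.+1 => match boolp.pselect (exists x, reduces c x) with
             | left h => lin (pin n') (sval (boolp.cid h))
             | right _ => Z c
             end
  end.

(* [lin pi] projects onto the span of the generators along the brackets. *)
Definition pi c := pin (rank c).+1 c.

Lemma pin_stable n n' c : (rank c < n)%N -> (rank c < n')%N -> pin n c = pin n' c.
Proof.
elim: n n' c => [|n IHn] [|n'] c.
- by move=> _ _.
- by move=> cn; exfalso; rewrite ltn0 in cn.
- by move=> _ cn; exfalso; rewrite ltn0 in cn.
move=> cn cn'; rewrite [pin n.+1 c]/= [pin n'.+1 c]/=; case: boolp.pselect => h; last by [].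
case: (boolp.cid h) => x [lx _] /=; apply: lin_eqw => d /lx[_ rd].
by apply: IHn; apply: leq_trans rd _.
Qed.

Lemma pi_gen c : generator c -> pi c = Z c.
Proof. by move=> gc; rewrite /pi [pin _ _]/=; case: boolp.pselect => // /gc. Qed.

Lemma pi_red c : ~ generator c -> exists2 x, reduces c x & pi c = lin pi x.
Proof.
move=> ngc; rewrite /pi [pin _ _]/=; case: boolp.pselect => h; last by case: ngc.
case: (boolp.cid h) => x rx /=.
exists x; first exact: rx.
apply: lin_eqw => d /rx.1[_ rd]; exact: pin_stable rd (ltnSn _).
Qed.

Lemma pi_hom c : hom (wt c) (pi c).
Proof.
move: {2}(rank c) (erefl (rank c)) => r.
elim/ltn_ind: r c => r IHr c rc.
have [gc|/pi_red[x rx ->]] := boolp.pselect (generator c).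
  by rewrite (pi_gen gc); apply: hom_Z.
move=> d; move/mcoeff_lin_neq0=> [a /rx.1[<- ra] nz].
by rewrite rc in ra; apply: (IHr _ ra a) nz.
Qed.

Lemma lin_pi_hom n x : hom n x -> hom n (lin pi x).
Proof. by move=> hx d; move/mcoeff_lin_neq0=> [c /hx <-]; apply: pi_hom. Qed.

(** Elimination of leading terms, by induction on a strict bound [m] for the ranks in [x]. The top
    class [c] cannot be a generator; its chosen reduction [y] gives [Z c - y], a bracket killed by
    the projection, and subtracting a multiple of it removes [c] from [x]. *)
Lemma lin_pi_Brk n x : Brk n x -> lin pi x = 0.
Proof.
move=> Bx.
have [m xm] : exists m, forall d : ctree, x@_d != 0 -> (rank d < m)%N.
  exists (\max_(d <- finmap.enum_fset (msupp x)) rank d).+1 => d.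
  by rewrite mcoeff_neq0 => dx; rewrite ltnS; apply: leq_bigmax_seq.
elim: m x Bx xm => [|m IHm] x Bx xm.
  suff -> : x = 0 by apply: sl0 (lin_linear pi).
  by apply: L1P => c; rewrite mcoeff0; apply/eqP; apply: contraT => /xm.
have [[c xc rc]|noc] := boolp.pselect (exists2 c : ctree, x@_c != 0 & rank c = m); last first.
  apply: IHm => // d xd; move: (xm _ xd); rewrite ltnS leq_eqVlt => /orP[/eqP rd|//].
  by case: noc; exists d.
have wc : wt c = n := Brk_hom Bx xc.
(* Solving [x] for its top class writes [Z c], modulo the bracket [x], through classes of smaller
   rank. *)
have ngc : ~ generator c.
  apply; exists (Z c - (x@_c)^-1 *: x); split; last first.
    by rewrite opprB addrCA subrr addr0 wc -[_ *: _]addr0; apply: Brk_comb => //; apply: Brk0.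
  move=> d; rewrite addrC -scaleNr mcoeff_comb mcoeff_Z mulNr.
  have [<-|cd] := eqVneq c d; first by rewrite mulVf // addNr eqxx.
  rewrite addr0 oppr_eq0 mulf_eq0 negb_or => /andP[_ xd].
  split; first by rewrite wc; apply: Brk_hom xd.
  by rewrite ltn_neqAle (inj_eq rank_inj) eq_sym cd rc -ltnS xm.
have [y [ly By] pic] := pi_red ngc.
have zpi : lin pi (Z c - y) = 0.
  by rewrite (slB (lin_linear pi)) lin_Z pic subrr.
apply: etrans (esym (sl_ker (lin_linear pi) (- x@_c) x zpi)) _.
apply: IHm.
  by apply: Brk_comb => //; rewrite -wc.
move=> d; rewrite mcoeff_comb mcoeffB mcoeff_Z.
have [<-|cd] := eqVneq c d.
  have -> : y@_c = 0 by apply/eqP; apply: contraT => /ly[_]; rewrite ltnn.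
  by rewrite subr0 mulr1 addNr eqxx.
rewrite sub0r mulrNN => nz.
have [y0|/ly[_]] := eqVneq (y@_d) 0; last by rewrite rc.
move: nz; rewrite y0 mulr0 add0r => xd.
by rewrite ltn_neqAle -rc (inj_eq rank_inj) eq_sym cd rc -ltnS xm.
Qed.

Lemma lin_fun_linear (V : lmodType rat) (a : rat) (f f1 f2 : ctree -> V) x :
  (forall c, f c = a *: f1 c + f2 c) -> lin f x = a *: lin f1 x + lin f2 x.
Proof.
move=> fE; rewrite /lin scaler_sumr -big_split; apply: eq_bigr => c _ /=.
by rewrite fE scalerDr !scalerA mulrC.
Qed.

Lemma Brk_br1_e t u : Brk (weight t + weight u) (br1 (e t) (e u)).
Proof.
have B c d : Brk (wt c + wt d) ((sig t * sig u) *: br1 (Z c) (Z d)).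
  by rewrite -[_ *: _]addr0; apply: BrkS (Brk0 _).
by have := B (cls t) (cls u); rewrite -br1_eE !wt_cls.
Qed.

(** * An action with prescribed operators on the generators *)

Section Action.

Variable V : lmodType rat.
Implicit Types (w : ctree -> V -> V) (m : V) (c : ctree).

Definition gof w K m : V := lin (w^~ m) (lin pi (e (RNode K))).

Lemma gof_linear w : (forall c, scalar_linear (w c)) ->
  forall K, scalar_linear (gof w K).
Proof. by move=> wL K a x y; apply: lin_fun_linear => c; apply: wL. Qed.

Lemma gof_invariant w m : invariant_on ((gof w)^~ m).
Proof. by move=> F F' FF'; rewrite /gof (e_feq FF'). Qed.

Lemma gof_kills_brackets w m : kills_brackets ((gof w)^~ m).
Proof.
move=> T T'.
have sumE A B : \sum_(X <- star (RNode A) B) gof w X m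
    = lin (w^~ m) (lin pi (\sum_(x <- gr (RNode A) (RNode B)) e x)).
  by rewrite (sl_sum (lin_linear pi)) (sl_sum (lin_linear (w^~ m))) sum_gr.
have := lin_pi_Brk (Brk_br1_e (RNode T) (RNode T')).
rewrite br1_e (slB (lin_linear pi)) => /subr0_eq eqpi.
by rewrite !sumE eqpi.
Qed.

Lemma gof_local w w' K m :
  (forall d, wt d = (fweight K).+1 -> w d m = w' d m) -> gof w K m = gof w' K m.
Proof.
move=> ww'; apply: lin_eqw => d /(lin_pi_hom (@hom_e (RNode K))); exact: ww'.
Qed.

Lemma gof_generator w c m : generator c ->
  gof w (children (val c)) m = sig (val c) *: w c m.
Proof.
move=> gc; rewrite /gof childrenK /e valK_cls (slZ (lin_linear pi)) lin_Z.
by rewrite (pi_gen gc) (slZ (lin_linear _)) lin_Z.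
Qed.

Variable h : ctree -> V -> V.
Hypothesis h_linear : forall c, scalar_linear (h c).

Definition correction w c m : V :=
  \sum_(p <- sk (children (val c)) | ~~ nilp p.1)
    rho (gof w) p.1 (gof w p.2 m).

Lemma correction_local w w' c m :
  (forall d x, (wt d < wt c)%N -> w d x = w' d x) ->
  correction w c m = correction w' c m.
Proof.
move=> ww'; rewrite /correction [LHS]big_seq_cond [RHS]big_seq_cond; apply: eq_bigr => p /andP[/sk_weight wp p1].
have p1_gt0 : (0 < fweight p.1)%N by rewrite lt0n fweight_eq0.
have -> : gof w p.2 m = gof w' p.2 m.
  apply: gof_local => d wd; apply: ww'.
  by rewrite wd weight_children ltnS wp -[ltnLHS]add0n ltn_add2r.
apply: rho_local => K x wK; apply: gof_local => d wd; apply: ww'.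
rewrite wd weight_children ltnS wp; apply: leq_trans wK _; exact: leq_addr.
Qed.

(** Solves [rho_tree_top] by recursion on the weight so that a generator acts by [h c]. The factor
    [sig] appears because [val c] stands for [e (val c)], a multiple of [Z c]; [wt c] is the
    coefficient of the top term. *)
Fixpoint Gn n (c : ctree) m : V :=
  match n with
  | 0 => 0
  | n'.+1 => (sig (val c) * (wt c)%:R)^-1 *:
               (sig (val c) *: h c m - correction (Gn n') c m)
  end.

Lemma Gn_stable n n' c m : (wt c <= n)%N -> (wt c <= n')%N -> Gn n c m = Gn n' c m.
Proof.
elim: n n' c m => [|n IHn] [|n'] c m cn cn'; do ?by have := wt_gt0 c; rewrite ltnNge ?cn ?cn'.
rewrite [LHS]/= [RHS]/=; congr (_ *: (_ - _)); apply: correction_local => d x dc.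
by apply: IHn; rewrite -ltnS; apply: leq_trans dc _.
Qed.

Lemma Gn_linear n c : scalar_linear (Gn n c).
Proof.
elim: n c => [|n IHn] c a x y; first by rewrite /= scaler0 addr0.
have cL : correction (Gn n) c (a *: x + y)
    = a *: correction (Gn n) c x + correction (Gn n) c y.
  rewrite /correction scaler_sumr -big_split; apply: eq_bigr => p _ /=.
  by rewrite (gof_linear IHn) (rho_linear (gof_linear IHn)).
rewrite [LHS]/= [RHS]/= cL h_linear; set k := (sig _ * _)^-1.
rewrite (scalerA a k) (mulrC a k) -scalerA -scalerDr; congr (k *: _).
rewrite scalerBr !scalerDr !scalerA (mulrC a) opprD; exact: addrACA.
Qed.

Definition Gh (c : ctree) m := Gn (wt c) c m.

Lemma Gh_linear c : scalar_linear (Gh c). Proof. exact: Gn_linear. Qed.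

Lemma GhE c m : Gh c m = (sig (val c) * (wt c)%:R)^-1 *:
               (sig (val c) *: h c m - correction Gh c m).
Proof.
rewrite /Gh; case wc: (wt c) (wt_gt0 c) => [|n] // _; rewrite [LHS]/= wc.
congr (_ *: (_ - _)); apply: correction_local => d x; rewrite wc ltnS => dn.
exact: Gn_stable.
Qed.

Lemma rho_Gh_generator c m : generator c ->
  rho (gof Gh) [:: val c] m = sig (val c) *: h c m.
Proof.
move=> gc; rewrite -(childrenK (val c)) rho_tree_top (gof_generator _ _ gc) childrenK.
rewrite -/(correction Gh c m) -weight_children GhE scalerA -scaler_nat scalerA.
rewrite mulrCA mulrA mulfV ?scale1r ?subrK // mulf_neq0 ?sig_neq0 //.
by rewrite pnatr_eq0 -lt0n wt_gt0.
Qed.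

Definition act (x : L1) m : V :=
  lin (fun c => (sig (val c))^-1 *: rho (gof Gh) [:: val c] m) x.

Lemma act_linearl m : scalar_linear (act^~ m).
Proof. exact: lin_linear. Qed.

Lemma act_linearr x : scalar_linear (act x).
Proof.
move=> a m m'; apply: lin_fun_linear => c.
rewrite -[val c]childrenK (rho_linear (gof_linear Gh_linear)).
by rewrite scalerDr !scalerA mulrC.
Qed.

Lemma act_e F m : act (e (RNode F)) m = rho (gof Gh) [:: RNode F] m.
Proof.
rewrite /act /e (slZ (lin_linear _)) lin_Z scalerA val_cls.
have [K cK] : exists K, canon (RNode F) = RNode K.
  by exists (children (canon (RNode F))); rewrite childrenK.
have FK : feq F K by apply: canonP; rewrite -cK canon_idem.
rewrite cK -(sig_feq FK) mulfV ?sig_neq0 ?scale1r //.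
apply: (rho_invariant (@gof_invariant Gh) (@gof_kills_brackets Gh)).
exact: feq_head (feq_sym FK).
Qed.

Lemma act_generator c m : generator c -> act (Z c) m = h c m.
Proof.
move=> gc; rewrite /act lin_Z (rho_Gh_generator _ gc) scalerA mulVf ?scale1r //.
exact: sig_neq0.
Qed.

Lemma act_br1_e F F' m : act (br1 (e (RNode F)) (e (RNode F'))) m
  = act (e (RNode F)) (act (e (RNode F')) m) - act (e (RNode F')) (act (e (RNode F)) m).
Proof.
have sumE A B : act (\sum_(x <- gr (RNode A) (RNode B)) e x) m
    = \sum_(X <- star (RNode A) B) rho (gof Gh) [:: RNode X] m.
  rewrite (sl_sum (act_linearl m)) sum_gr; apply: eq_bigr => X _; exact: act_e.
rewrite (br1_e (RNode F) (RNode F')) (slB (act_linearl m)) (sumE F F') (sumE F' F).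
have comp A B : act (e (RNode A)) (act (e (RNode B)) m)
    = rho (gof Gh) [:: RNode A] (rho (gof Gh) [:: RNode B] m).
  exact: etrans (congr1 (act _) (act_e B m)) (act_e A _).
refine (etrans _ (esym (congr2 (fun x y : V => x - y) (comp F F') (comp F' F)))).
apply: rho_bracket.
- exact: gof_linear Gh_linear.
- exact: gof_invariant.
- exact: gof_kills_brackets.
Qed.

Lemma act_br1_Z c d m : act (br1 (Z c) (Z d)) m
  = act (Z c) (act (Z d) m) - act (Z d) (act (Z c) m).
Proof.
have actZ b n : act (Z b) n = (sig (val b))^-1 *: act (e (val b)) n.
  exact: etrans (congr1 (act^~ n) (Z_e b)) (slZ (act_linearl n) _ _).
have comp a b : act (Z a) (act (Z b) m)
    = ((sig (val a))^-1 * (sig (val b))^-1) *: act (e (val a)) (act (e (val b)) m).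
  refine (etrans (actZ a _) _).
  refine (etrans (congr1 (fun x : V => _ *: act (e (val a)) x) (actZ b m)) _).
  refine (etrans (congr1 (fun x : V => _ *: x) (slZ (act_linearr (e (val a))) _ _)) _).
  exact: scalerA.
refine (etrans _ (esym (congr2 (fun x y : V => x - y) (comp c d) (comp d c)))).
refine (etrans (congr1 (act^~ m) (br1_ZE c d)) _).
refine (etrans (slZ (act_linearl m) _ _) _).
rewrite (mulrC (sig (val d))^-1) -scalerBr; congr (_ *: _).
have bracket t u : act (br1 (e t) (e u)) m = act (e t) (act (e u) m) - act (e u) (act (e t) m).
  by case: t u => [F] [F']; exact: act_br1_e.
exact: bracket.
Qed.

End Action.

(** The universal property in module form; morphisms to a Lie algebra are extracted from it by a
    suitable choice of [V] and [h]. *)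
Lemma tree_action (V : lmodType rat) (h : ctree -> V -> V) :
  (forall c, scalar_linear (h c)) ->
  exists a : L1 -> V -> V,
    [/\ forall m, scalar_linear (a^~ m), forall x, scalar_linear (a x),
        forall c d m, a (br1 (Z c) (Z d)) m = a (Z c) (a (Z d) m) - a (Z d) (a (Z c) m)
      & forall c m, generator c -> a (Z c) m = h c m].
Proof.
move=> hL; exists (act h); split.
- exact: act_linearl.
- exact: act_linearr.
- exact: act_br1_Z.
- exact: act_generator.
Qed.

(** * The generators generate: uniqueness of morphisms *)

Lemma L1_ind_Z (P : L1 -> Prop) : P 0 -> (forall a x y, P x -> P y -> P (a *: x + y)) ->
  (forall c, P (Z c)) -> forall x, P x.
Proof.
move=> P0 PD PZ x; rewrite (L1_sum x); apply: (big_rec P) => // c y _ Py.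
exact: PD.
Qed.

(** By [ctree_gen_ind], agreement passes to brackets of lighter classes and to the earlier classes
    in a reduction, hence to the class itself. *)
Lemma lie_morphism_eq (M : lieAlgebra) (phi psi : L1 -> M) :
  is_lie_morphism br1 (@lie_br M) phi -> is_lie_morphism br1 (@lie_br M) psi ->
  (forall c, generator c -> phi (Z c) = psi (Z c)) -> forall v, phi v = psi v.
Proof.
move=> [phiL phiB] [psiL psiB] eq_gen v.
have eqZ c : phi (Z c) = psi (Z c).
  elim/ctree_gen_ind: c => [//|c x eq_lt eq_low Bx].
  have eq_Brk y : Brk (wt c) y -> phi y = psi y.
    elim=> [|b d d' z wd _ IH]; first by rewrite (sl0 phiL) (sl0 psiL).
    have eqd : phi (Z d) = psi (Z d).
      by apply: eq_lt; rewrite -wd -[ltnLHS]addn0 ltn_add2l wt_gt0.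
    have eqd' : phi (Z d') = psi (Z d').
      by apply: eq_lt; rewrite -wd -[ltnLHS]add0n ltn_add2r wt_gt0.
    have eqB : phi (br1 (Z d) (Z d')) = psi (br1 (Z d) (Z d')).
      exact: etrans (phiB _ _) (etrans (congr2 _ eqd eqd') (esym (psiB _ _))).
    by rewrite (phiL b) (psiL b) IH eqB.
  have eqx : phi x = psi x.
    by rewrite (lin_unique phiL) (lin_unique psiL); apply: lin_eqw => d /eq_low[].
  by have := eq_Brk _ Bx; rewrite (slB phiL) (slB psiL) eqx => /addIr.
by rewrite (lin_unique phiL) (lin_unique psiL); apply: lin_eqw => d _.
Qed.

Lemma bilinear_morphism (V W : lmodType rat) (brV : V -> V -> V) (brW : W -> W -> W)
    (phi : V -> W) (I : Type) (b : I -> V) :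
  (forall y, scalar_linear (brV^~ y)) -> (forall x, scalar_linear (brV x)) ->
  (forall y, scalar_linear (brW^~ y)) -> (forall x, scalar_linear (brW x)) ->
  scalar_linear phi ->
  (forall P : V -> Prop, P 0 -> (forall a x y, P x -> P y -> P (a *: x + y)) ->
     (forall i, P (b i)) -> forall x, P x) ->
  (forall i j, phi (brV (b i) (b j)) = brW (phi (b i)) (phi (b j))) ->
  forall x y, phi (brV x y) = brW (phi x) (phi y).
Proof.
move=> Vl Vr Wl Wr phiL b_ind phi_b x y.
elim/b_ind: x => [|a x x' IH IH'|i].
- by rewrite (sl0 (Vl y)) (sl0 phiL) (sl0 (Wl _)).
- by rewrite (Vl y a x x') !phiL IH IH' (Wl _).
elim/b_ind: y => [|a y y' IH IH'|j] //.
- by rewrite (sl0 (Vr _)) (sl0 phiL) (sl0 (Wr _)).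
- by rewrite (Vr _ a y y') !phiL IH IH' (Wr _).
Qed.

(** * Freeness *)

Section Dynkin.

Variable M : lieAlgebra.
Local Notation br := (@lie_br M).

Lemma brl (y : M) : scalar_linear (br^~ y).
Proof. by move=> a x x'; case: (lie_axioms M) => ->. Qed.

Lemma brr (x : M) : scalar_linear (br x).
Proof. by move=> a y y'; case: (lie_axioms M) => _ ->. Qed.

Lemma br_anti (x y : M) : br x y = - br y x.
Proof.
case: (lie_axioms M) => _ _ alt _; have := alt (x + y).
rewrite (slD (brl _)) !(slD (brr _)) !alt add0r addr0 => /eqP.
by rewrite addr_eq0 => /eqP.
Qed.

Lemma br_jacobi (x y z : M) : br x (br y z) - br y (br x z) = br (br x y) z.
Proof.
case: (lie_axioms M) => _ _ _ jac; have := jac x y z.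
rewrite (br_anti z x) (slN (brr y)) (br_anti z) => /eqP.
by rewrite subr_eq0 => /eqP.
Qed.

(* [M * rat] is acted upon by the semidirect product of [M] with its grading
   derivation, of degree [n] on the elements of weight [n]. *)
Definition dynkin (n : nat) (p : M) (v : M * rat^o) : M * rat^o :=
  (br p v.1 + (v.2 * n%:R) *: p, 0).

Lemma dynkin_linear n p : scalar_linear (dynkin n p).
Proof.
move=> a [x q] [y q']; apply: injective_projections => /=; last by rewrite scaler0 addr0.
rewrite brr scalerDr mulrDl scalerDl scalerA -[a *: (q : rat^o)]/(a * q) -mulrA.
exact: addrACA.
Qed.

Lemma dynkin_comb n a p p' v : dynkin n (a *: p + p') v = a *: dynkin n p v + dynkin n p' v.
Proof.
apply: injective_projections => /=; last by rewrite scaler0 addr0.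
rewrite brl !scalerDr !scalerA (mulrC a); exact: addrACA.
Qed.

(** The adjoint part is the Jacobi identity; the part in [v.2] is the derivation rule, by which
    degrees add. *)
Lemma dynkin_br n k p p' v : dynkin n p (dynkin k p' v) - dynkin k p' (dynkin n p v)
  = dynkin (n + k) (br p p') v.
Proof.
apply: injective_projections => /=; last by rewrite subrr.
rewrite !mul0r !scale0r !addr0 !(slD (brr _)) !(slZ (brr _)) opprD addrACA br_jacobi.
congr (_ + _); rewrite (br_anti p' p) scalerN opprK -scalerDl natrD mulrDr addrC.
by rewrite addrC [X in X *: _]addrC.
Qed.

(** Evaluation at [(0, 1)] returns [n] times [p]. The extra coordinate detects the centre of [M],
    which the adjoint action alone would lose. *)
Lemma dynkin_inj n p p' : (0 < n)%N -> dynkin n p =1 dynkin n p' -> p = p'.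
Proof.
move=> n0 /(_ (0, 1)) /(congr1 fst) /=.
rewrite !(sl0 (brr _)) !add0r mul1r; apply: scalerI.
by rewrite pnatr_eq0 -lt0n.
Qed.

Lemma lie_morphism_ex (f : L1 -> M) : exists phi : L1 -> M,
  is_lie_morphism br1 br phi /\ (forall c, generator c -> phi (Z c) = f (Z c)).
Proof.
have [a [aL aR aB aG]] := tree_action (fun c => dynkin_linear (wt c) (f (Z c))).
(* [Q n x p] says that [p] is a candidate image of [x] in degree [n]; such candidates are stable
   under combinations and brackets. *)
pose Q n x p := a x =1 dynkin n p.
have Q_comb n b x y p p' : Q n x p -> Q n y p' -> Q n (b *: x + y) (b *: p + p').
  by move=> Qx Qy v; rewrite aL dynkin_comb Qx Qy.
have Q0 n : Q n 0 0.
  move=> v; rewrite (sl0 (aL v)); apply: injective_projections => //=.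
  by rewrite (sl0 (brl _)) scaler0 addr0.
have Q_br n k c d p p' : Q n (Z c) p -> Q k (Z d) p' -> Q (n + k)%N (br1 (Z c) (Z d)) (br p p').
  move=> Qc Qd v; refine (etrans (aB c d v) (etrans _ (dynkin_br n k p p' v))).
  by congr (_ - _); [exact: etrans (congr1 _ (Qd v)) (Qc _)|exact: etrans (congr1 _ (Qc v)) (Qd _)].
have Q_lin n x P : (forall d : ctree, x@_d != 0 -> Q n (Z d) (P d)) -> Q n x (lin P x).
  move=> QP v; rewrite (lin_unique (aL v)).
  have dL : scalar_linear (fun p => dynkin n p v) by move=> b p p'; apply: dynkin_comb.
  rewrite /lin (sl_sum dL); apply: eq_big_seq => d dx.
  by rewrite (slZ dL) (QP d) // mcoeff_neq0.
have exQ c : exists p, Q (wt c) (Z c) p.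
  elim/ctree_gen_ind: c => [c gc|c x Qlt Qlow Bx].
    by exists (f (Z c)) => v; apply: aG.
  have [p Qp] : exists p, Q (wt c) (Z c - x) p.
    elim: Bx => [|b d d' y wd _ [p Qp]]; first by exists 0; apply: Q0.
    have [q Qq] : exists q, Q (wt d) (Z d) q.
      by apply: Qlt; rewrite -wd -[ltnLHS]addn0 ltn_add2l wt_gt0.
    have [q' Qq'] : exists q', Q (wt d') (Z d') q'.
      by apply: Qlt; rewrite -wd -[ltnLHS]add0n ltn_add2r wt_gt0.
    exists (b *: br q q' + p); apply: Q_comb Qp; rewrite -wd; exact: Q_br.
  (* Outside the support of [x] the value 0 is a placeholder that makes the choice total. *)
  have exQx (d : ctree) : exists q, x@_d != 0 -> Q (wt c) (Z d) q.
    have [x0|xd] := eqVneq (x@_d) 0; first by exists 0.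
    by have [wd [q Qq]] := Qlow d xd; exists q; rewrite -wd.
  have [P PQ] := boolp.choice exQx.
  have := Q_comb _ 1 _ _ _ _ Qp (Q_lin _ _ _ PQ).
  by rewrite scale1r subrK => QZ; eexists; exact: QZ.
have [P PQ] := boolp.choice exQ.
have P_hom n x : hom n x -> Q n x (lin P x).
  by move=> hx; apply: Q_lin => d /hx <-.
have P_gen c : generator c -> P c = f (Z c).
  by move=> gc; apply: (dynkin_inj (wt_gt0 c)) => v; rewrite -(PQ c v); apply: aG.
(* Both sides represent the action of the bracket in degree [wt c + wt d], which is positive, so
   [dynkin_inj] equates them. *)
have P_br c d : lin P (br1 (Z c) (Z d)) = br (P c) (P d).
  apply: (@dynkin_inj (wt c + wt d)); first by rewrite addn_gt0 wt_gt0.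
  move=> v; rewrite -(P_hom _ _ (@hom_br1_Z c d) v); exact: Q_br.
have PL := lin_linear P.
exists (lin P); split; last by move=> c gc; rewrite lin_Z; apply: P_gen.
split; first exact: PL.
move=> x y.
apply: (bilinear_morphism br1_linearl br1_linearr brl brr PL L1_ind_Z) => c d.
refine (etrans (P_br c d) (congr2 _ (esym (lin_Z P c)) (esym (lin_Z P d)))).
Qed.

End Dynkin.

Theorem theorem8p4 : is_free_lie br1.
Proof.
split; first exact: br1_lie.
exists (fun v => exists2 c, generator c & v = Z c) => M f; split.
  have [phi [phiP phi_gen]] := lie_morphism_ex f.
  by exists phi; split=> // x [c gc ->]; apply: phi_gen.
move=> phi psi phiP psiP eqX; apply: lie_morphism_eq phiP psiP _ => c gc.
by apply: eqX; exists c.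
Qed.
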